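(* Let $\gamma_\ell\ge 0$, $\ell\ge 1$, satisfy $\gamma_1=0$ and $\sum_{\ell=2}^\infty \ell\gamma_\ell=1$. Then there is a unique global in time solution, i.e. a unique continuous nonnegative function $c_1:[0,\infty)\to\mathbf{R}$ together with a unique family of nonnegative functions $c(\ell,t)$, $\ell\ge 2$, $t\ge 0$, of the system $$\frac{\partial c(\ell,t)}{\partial t}=J(\ell-1,c,t)-J(\ell,c,t),\quad \ell\ge 2,\ t>0,$$ where $J(\ell,c,t)=a_\ell c_1(t)c(\ell,t)-b_{\ell+1}c(\ell+1,t)$ for $\ell\ge 1$, with boundary and initial conditions $$c(1,t)=0,\ t\ge 0,\qquad c(\ell,0)=\gamma_\ell,\ \ell\ge 2,$$ and subject to the conservation law $$\sum_{\ell=2}^\infty \ell\, c(\ell,t)=1,\qquad t\ge 0.$$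
   Context: Constants $a_1>0$, $z_s>0$, $q>0$ are fixed, and $a_\ell=a_1\ell^{1/3}$, $b_\ell=a_\ell\left(z_s+q/\ell^{1/3}\right)$ for $\ell\ge 1$. The function $c_1(t)$ is one of the unknowns of the system (it plays the role of the monomer density and is determined by the conservation law); it is distinct from the boundary value $c(1,t)$, which is identically $0$. *)

(* Defs.v *)
From Stdlib Require Import Reals.
From Coquelicot Require Import Coquelicot.

Open Scope R_scope.

Definition a_coef (a1 : R) (l : nat) : R := a1 * Rpower (INR l) (1 / 3).

Definition b_coef (a1 zs q : R) (l : nat) : R :=
  a_coef a1 l * (zs + q / Rpower (INR l) (1 / 3)).

(* The unknown [c1] (monomer density) is unrelated to the boundary value [c 1%nat]. *)
Definition J (a1 zs q : R) (c1 : R -> R) (c : nat -> R -> R) (l : nat) (t : R) : R :=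
  a_coef a1 l * c1 t * c l t - b_coef a1 zs q (l + 1) * c (l + 1)%nat t.

(* Functions of time are total on [R], but only their values at [t >= 0] and
   [l >= 1] are constrained. Without [sol_c_cont] at [t = 0], the initial data
   would not be tied to the evolution for [t > 0]. *)
Record is_global_solution (a1 zs q : R) (gamma : nat -> R)
    (c1 : R -> R) (c : nat -> R -> R) : Prop := {
  sol_c1_cont : continuous_on (fun t => 0 <= t) c1;
  sol_c1_ge0 : forall t, 0 <= t -> 0 <= c1 t;
  sol_c_cont : forall l, (2 <= l)%nat -> continuous_on (fun t => 0 <= t) (c l);
  sol_c_ge0 : forall l t, (2 <= l)%nat -> 0 <= t -> 0 <= c l t;
  sol_ode : forall l t, (2 <= l)%nat -> 0 < t ->
    is_derive (c l) t (J a1 zs q c1 c (l - 1) t - J a1 zs q c1 c l t);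
  sol_boundary : forall t, 0 <= t -> c 1%nat t = 0;
  sol_initial : forall l, (2 <= l)%nat -> c l 0 = gamma l;
  sol_conservation : forall t, 0 <= t ->
    is_series (fun k : nat => INR (k + 2) * c (k + 2)%nat t) 1
}.

(* Main.v *)
Require Import Defs.
From Stdlib Require Import Reals Arith Lra Lia IndefiniteDescription.
From Coquelicot Require Import Coquelicot.

(** Summing the equations against [l] shows that the conservation law is equivalent to
    [c_1(t) * sum a_l c(l,t) = sum b_l c(l,t) + b_2 c(2,t)], which bounds [c_1] by
    [2 (z_s + q)]. In the weighted norm [sum a_l |c(l,t)|], two solutions of this closed
    system satisfy a Gronwall estimate: the commutators only involve the bounded increments
    of [a_l], the perturbation of [c_1] is controlled by [sum a_l^2 c(l,t) <= C sum l c(l,t)],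
    and [sum a_l c(l,t)] stays away from zero on compact time intervals. The estimate also
    holds, up to an error [O(n^(-1/3))], between functions solving only the first [n]
    equations. Hence it yields uniqueness, and it makes the solutions of the systems
    truncated at [n] a Cauchy sequence, whose limit solves the full system. *)

(** The weight [a_l] is forced from two sides. Since [c_1] is a quotient of two sums of order
    [a_l c(l,t)], comparing two values of [c_1] takes a norm with weight at least [a_l]. The
    difference of these values then multiplies the growth operator applied to the other solution;
    this costs one more factor [a_l], to be paid for by the only moment under control, the mass. As
    [a_l] is of order [l^(1/3)], the square [a_l^2] stays below [l], and the ratio [a_l^2 / l] is
    the source of the error [n^(-1/3)].

    In the bound on [c_1], [z_s + q] comes from [b_l <= (z_s + q) a_l], and the factor 2 from
    dimers, which release two monomers.

    The delicate point of the equivalence is that the mass cannot be differentiated term by term: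
    nothing makes the flux past size [n] small at a given time. Both directions go through a cutoff
    of the weight [l] with bounded increments.

    Exact and truncated solutions enter through one predicate, [approx], so that a single estimate,
    [approx_stable], serves existence and uniqueness. *)

Open Scope R_scope.

(** * Real analysis *)

Lemma continuous_eps (f : R -> R) (t : R) :
  continuous f t <->
  forall eps, 0 < eps ->
    exists d, 0 < d /\ forall s, Rabs (s - t) < d -> Rabs (f s - f t) < eps.
Proof.
  split.
  - intros H eps He.
    apply filterlim_locally with (eps := mkposreal eps He) in H.
    destruct H as [d Hd]. exists d. split; [apply cond_pos|].
    intros s Hs. apply (Hd s), Hs.
  - intros H. apply filterlim_locally. intros eps.
    destruct (H eps (cond_pos eps)) as [d [Hd Hs]].
    exists (mkposreal d Hd). intros s Hb. apply Hs, Hb.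
Qed.

(** Freezing a function at its value at 0 for negative times turns one-sided continuity at 0 into
    continuity on the whole line. All functions of time are put in this form, so that later lemmas
    may assume continuity everywhere. *)
Lemma continuous_Rmax0 (f : R -> R) :
  continuous_on (fun t => 0 <= t) f ->
  forall t, continuous (fun s => f (Rmax 0 s)) t.
Proof.
  intros H t. apply continuous_eps. intros eps He.
  specialize (H (Rmax 0 t) (Rmax_l 0 t)).
  apply filterlim_locally with (eps := mkposreal eps He) in H.
  destruct H as [d Hd]. exists d. split; [apply cond_pos|].
  intros s Hs. apply (Hd (Rmax 0 s)); [|apply Rmax_l].
  change (Rabs (Rmax 0 s - Rmax 0 t) < d).
  apply Rle_lt_trans with (Rabs (s - t)); [|exact Hs].
  unfold Rmax. destruct (Rle_dec 0 s), (Rle_dec 0 t);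
    unfold Rabs; repeat destruct Rcase_abs; lra.
Qed.

Lemma le_of_derive_nonpos (f f' : R -> R) (a b : R) :
  (forall t, continuous f t) ->
  (forall t, a < t < b -> is_derive f t (f' t)) ->
  (forall t, a < t < b -> f' t <= 0) ->
  a <= b -> f b <= f a.
Proof.
  intros Hc Hd Hs Hab.
  (* The mean value point may be an endpoint, where nothing is known about [f']; there [df] is set
     to 0, which has the required sign. *)
  set (df := fun x => if Rlt_dec a x then (if Rlt_dec x b then f' x else 0) else 0).
  destruct (MVT_gen f a b df) as [c [_ Hc']].
  - intros x. rewrite Rmin_left, Rmax_right by lra. intros Hx.
    unfold df. destruct (Rlt_dec a x); [|lra]. destruct (Rlt_dec x b); [|lra].
    apply Hd. lra.
  - intros x _. apply continuity_pt_filterlim, Hc.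
  - assert (df c <= 0).
    { unfold df. destruct (Rlt_dec a c); [|lra]. destruct (Rlt_dec c b); [|lra].
      apply Hs. lra. }
    nra.
Qed.

Lemma le_initial_of_derive_nonpos (f f' : R -> R) (T : R) :
  (forall t, continuous f t) ->
  (forall t, 0 < t < T -> is_derive f t (f' t)) ->
  (forall t, 0 < t < T -> f' t <= 0) ->
  forall t, 0 <= t <= T -> f t <= f 0.
Proof.
  intros Hc Hd Hs t Ht. apply le_of_derive_nonpos with f'; auto; [| |lra];
    intros s Hs'; [apply Hd|apply Hs]; lra.
Qed.

Lemma abs_le_of_derive_le (f f' h h' : R -> R) (T : R) :
  (forall t, continuous f t) -> (forall t, continuous h t) ->
  (forall t, 0 < t < T -> is_derive f t (f' t)) ->
  (forall t, 0 < t < T -> is_derive h t (h' t)) ->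
  (forall t, 0 < t < T -> Rabs (f' t) <= h' t) ->
  Rabs (f 0) <= h 0 ->
  forall t, 0 <= t <= T -> Rabs (f t) <= h t.
Proof.
  intros Hcf Hch Hf Hh Hle H0 t Ht.
  apply Rabs_le_between in H0. apply Rabs_le. split.
  - assert (E : (fun s => - f s - h s) t <= (fun s => - f s - h s) 0); [|simpl in E; lra].
    apply (le_initial_of_derive_nonpos (fun s => - f s - h s) (fun s => - f' s - h' s) T); auto.
    + intros s. apply (continuous_minus (fun s => - f s) h); auto.
      apply (continuous_opp f); auto.
    + intros s Hs. apply (is_derive_minus (fun s => - f s) h); auto.
      apply (is_derive_opp f); auto.
    + intros s Hs. specialize (Hle s Hs). apply Rabs_le_between in Hle. lra.
  - assert (E : (fun s => f s - h s) t <= (fun s => f s - h s) 0); [|simpl in E; lra].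
    apply (le_initial_of_derive_nonpos (fun s => f s - h s) (fun s => f' s - h' s) T); auto.
    + intros s. apply (continuous_minus f h); auto.
    + intros s Hs. apply (is_derive_minus f h); auto.
    + intros s Hs. specialize (Hle s Hs). apply Rabs_le_between in Hle. lra.
Qed.

Lemma is_derive_exp_scal (k t : R) : is_derive (fun s => exp (k * s)) t (k * exp (k * t)).
Proof. auto_derive; [trivial|ring]. Qed.

Lemma continuous_exp_scal (k t : R) : continuous (fun s => exp (k * s)) t.
Proof.
  apply (ex_derive_continuous (fun s => exp (k * s))).
  exists (k * exp (k * t)). apply is_derive_exp_scal.
Qed.

Lemma gronwall (f f' : R -> R) (K M T : R) :
  0 <= K -> 0 <= M ->
  (forall t, continuous f t) ->
  (forall t, 0 < t < T -> is_derive f t (f' t)) ->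
  (forall t, 0 < t < T -> f' t <= K * f t + M) ->
  forall t, 0 <= t <= T -> f t <= exp (K * t) * (f 0 + M * t).
Proof.
  intros HK HM Hc Hd Hle t Ht.
  (* Since [exp (- K * s) <= 1] and [0 <= M], the derivative of [exp (- K * s) * f s] is at most
     [M]; this cruder bound avoids integrating the exponential. *)
  set (h := fun s => exp (- K * s) * f s - M * s).
  assert (E : h t <= h 0).
  { apply le_initial_of_derive_nonpos with
      (fun s => exp (- K * s) * (f' s - K * f s) - M) T; auto.
    - intros s. apply (continuous_minus (fun s => exp (- K * s) * f s) (fun s => M * s)).
      + apply (continuous_mult (fun s => exp (- K * s)) f); auto.
        apply continuous_exp_scal.
      + apply (continuous_mult (fun s => M) (fun s => s)).
        apply continuous_const. apply continuous_id.
    - intros s Hs.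
      replace (exp (- K * s) * (f' s - K * f s) - M)
        with ((- K * exp (- K * s) * f s + exp (- K * s) * f' s) - M) by ring.
      apply (is_derive_minus (fun s => exp (- K * s) * f s) (fun s => M * s)).
      + apply (is_derive_mult (fun s => exp (- K * s)) f).
        apply is_derive_exp_scal. auto. intros; apply Rmult_comm.
      + auto_derive; [trivial|ring].
    - intros s Hs. specialize (Hle s Hs).
      assert (0 < exp (- K * s) <= 1).
      { split. apply exp_pos. rewrite <- exp_0.
        apply Rle_ge in HK.
        destruct (Req_dec (K * s) 0) as [E|E].
        - replace (- K * s) with 0 by lra. lra.
        - left. apply exp_increasing. nra. }
      nra. }
  unfold h in E. rewrite !Rmult_0_r, exp_0 in E.
  assert (Ex : exp (K * t) * exp (- K * t) = 1).
  { rewrite <- exp_plus. replace (K * t + - K * t) with 0 by ring. apply exp_0. }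
  assert (P := exp_pos (K * t)).
  replace (f t) with (exp (K * t) * (exp (- K * t) * f t)).
  - apply Rmult_le_compat_l; lra.
  - rewrite <- Rmult_assoc, Ex. ring.
Qed.

Lemma continuous_uniform_limit (f : nat -> R -> R) (F : R -> R) :
  (forall m t, continuous (f m) t) ->
  (forall T eps, 0 < eps ->
     exists m, forall t, 0 <= t <= T -> Rabs (f m t - F t) <= eps) ->
  forall t, continuous (fun s => F (Rmax 0 s)) t.
Proof.
  intros Hc Hu t. apply continuous_eps. intros eps He.
  destruct (Hu (Rmax 0 t + 1) (eps / 4)) as [m Hm]; [lra|].
  assert (Hr := continuous_Rmax0 (f m) (continuous_on_forall _ _ (fun s _ => Hc m s)) t).
  rewrite continuous_eps in Hr. destruct (Hr (eps / 4)) as [d [Hd Hs]]; [lra|].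
  exists (Rmin d 1). split; [apply Rmin_glb_lt; lra|].
  intros s H.
  assert (H1 := Rlt_le_trans _ _ _ H (Rmin_l _ _)).
  assert (H2 := Rlt_le_trans _ _ _ H (Rmin_r _ _)).
  specialize (Hs s H1).
  assert (B : 0 <= Rmax 0 s <= Rmax 0 t + 1).
  { split; [apply Rmax_l|]. apply Rabs_lt_between in H2.
    unfold Rmax. destruct (Rle_dec 0 s), (Rle_dec 0 t); lra. }
  assert (C : 0 <= Rmax 0 t <= Rmax 0 t + 1) by (split; [apply Rmax_l|lra]).
  assert (X := Hm _ B). assert (Y := Hm _ C).
  apply Rabs_le_between in X. apply Rabs_le_between in Y. apply Rabs_lt_between in Hs.
  apply Rabs_lt_between. lra.
Qed.

Lemma is_lim_seq_abs_le (u : nat -> R) (l c e : R) (N : nat) :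
  is_lim_seq u l -> (forall m, (N <= m)%nat -> Rabs (u m - c) <= e) -> Rabs (l - c) <= e.
Proof.
  intros Hl Hb.
  assert (H1 : Rbar_le l (c + e)).
  { apply is_lim_seq_le_loc with u (fun _ => c + e); auto.
    - exists N. intros m Hm. specialize (Hb m Hm). apply Rabs_le_between in Hb. lra.
    - apply is_lim_seq_const. }
  assert (H2 : Rbar_le (c - e) l).
  { apply is_lim_seq_le_loc with (fun _ => c - e) u; auto.
    - exists N. intros m Hm. specialize (Hb m Hm). apply Rabs_le_between in Hb. lra.
    - apply is_lim_seq_const. }
  simpl in H1, H2. apply Rabs_le. lra.
Qed.

Lemma is_derive_primitive (g : R -> R) (t : R) :
  (forall s, continuous g s) -> is_derive (fun s => RInt g 0 s) t (g t).
Proof.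
  intros Hg. apply is_derive_RInt with (a := 0).
  - apply filter_forall. intros s. apply RInt_correct, ex_RInt_continuous. auto.
  - apply Hg.
Qed.

(** Each [f m] is compared with the primitive of [g], and the difference passes to the limit. The
    derivatives are required only for large [m], because the system truncated at [m] contains a
    given equation only from some [m] on. *)
Lemma is_derive_limit (f f' : nat -> R -> R) (F g : R -> R) :
  (forall m t, continuous (f m) t) ->
  (forall t, continuous g t) ->
  (forall T eps, 0 < eps -> exists M, forall m, (M <= m)%nat ->
     forall t, 0 < t < T -> is_derive (f m) t (f' m t) /\ Rabs (f' m t - g t) <= eps) ->
  (forall t, 0 <= t -> is_lim_seq (fun m => f m t) (F t)) ->
  forall t, 0 < t -> is_derive F t (g t).
Proof.
  intros Hc Hg Hu Hl.
  set (H := fun t => RInt g 0 t).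
  assert (HH : forall t, is_derive H t (g t)) by (intros; apply is_derive_primitive, Hg).
  assert (Hcont : forall t, continuous H t)
    by (intros s; apply (ex_derive_continuous H); exists (g s); apply HH).
  assert (H0 : H 0 = 0) by (unfold H; apply (RInt_point 0 g)).
  assert (E : forall t, 0 <= t -> F t = F 0 + H t).
  { intros t Ht. apply Rminus_diag_uniq, Rabs_eq_0, Rle_antisym; [|apply Rabs_pos].
    apply le_epsilon. intros eps He. rewrite Rplus_0_l.
    destruct (Hu (t + 1) (eps / (t + 1))) as [M HM].
    { apply Rdiv_lt_0_compat; lra. }
    assert (Hlim : is_lim_seq (fun m => f m t - f m 0) (F t - F 0)).
    { apply is_lim_seq_minus'; apply Hl; lra. }
    replace (F t - (F 0 + H t)) with (F t - F 0 - H t) by ring.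
    apply is_lim_seq_abs_le with (fun m => f m t - f m 0) M; auto.
    intros m Hm.
    assert (X : Rabs ((fun s => f m s - f m 0 - H s) t) <= (fun s => eps / (t + 1) * s) t).
    { apply (abs_le_of_derive_le (fun s => f m s - f m 0 - H s)
        (fun s => f' m s - g s) (fun s => eps / (t + 1) * s) (fun _ => eps / (t + 1)) (t + 1)).
      - intros s. apply (continuous_minus (fun s => f m s - f m 0) H); auto.
        apply (continuous_minus (f m) (fun _ => f m 0)); auto. apply continuous_const.
      - intros s. apply (continuous_mult (fun _ => eps / (t + 1)) (fun s => s)).
        apply continuous_const. apply continuous_id.
      - intros s Hs. replace (f' m s - g s) with (f' m s - 0 - g s) by ring.
        apply (is_derive_minus (fun s => f m s - f m 0) H); auto.
        apply (is_derive_minus (f m) (fun _ => f m 0)). apply HM; auto.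
        apply @is_derive_const.
      - intros s Hs. auto_derive; [trivial|ring].
      - intros s Hs. apply HM; auto.
      - rewrite H0, Rmult_0_r. replace (f m 0 - f m 0 - 0) with 0 by ring.
        rewrite Rabs_R0. lra.
      - lra. }
    simpl in X. apply Rle_trans with (1 := X).
    apply Rmult_le_reg_r with (t + 1); [lra|].
    replace (eps / (t + 1) * t * (t + 1)) with (eps * t) by (field; lra). nra. }
  intros t Ht.
  apply is_derive_ext_loc with (fun s => F 0 + H s).
  - exists (mkposreal t Ht). intros s Hs. symmetry. apply E.
    change (Rabs (s - t) < t) in Hs. apply Rabs_lt_between in Hs. lra.
  - replace (g t) with (0 + g t) by ring.
    apply (is_derive_plus (fun _ => F 0) H); auto. apply @is_derive_const.
Qed.

Lemma is_derive_sum_f_R0 (f d : nat -> R -> R) (n : nat) (t : R) :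
  (forall k, (k <= n)%nat -> is_derive (f k) t (d k t)) ->
  is_derive (fun s => sum_f_R0 (fun k => f k s) n) t (sum_f_R0 (fun k => d k t) n).
Proof.
  intros H. rewrite <- sum_n_Reals.
  apply is_derive_ext with (fun s => sum_n (fun k => f k s) n).
  - intros s. apply sum_n_Reals.
  - apply @is_derive_sum_n with (d := fun k => d k t), H.
Qed.

Lemma continuous_sum_f_R0 (f : nat -> R -> R) (n : nat) (t : R) :
  (forall k, (k <= n)%nat -> continuous (f k) t) ->
  continuous (fun s => sum_f_R0 (fun k => f k s) n) t.
Proof.
  induction n; intros H; simpl.
  - apply (H 0%nat). lia.
  - apply (continuous_plus (fun s => sum_f_R0 (fun k => f k s) n) (f (S n))).
    + apply IHn. intros; apply H; lia.
    + apply H; lia.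
Qed.

Lemma sum_f_R0_indicator (h : nat -> R) (m n : nat) :
  (m <= n)%nat ->
  sum_f_R0 (fun k => if le_dec k m then h k else 0) n = sum_f_R0 h m.
Proof.
  induction 1 as [|n Hn IH].
  - apply sum_eq. intros k Hk. destruct (le_dec k m); [reflexivity|lia].
  - simpl. rewrite IH. destruct (le_dec (S n) m); [lia|ring].
Qed.

Lemma sum_f_R0_nonneg (f : nat -> R) (n : nat) :
  (forall k, (k <= n)%nat -> 0 <= f k) -> 0 <= sum_f_R0 f n.
Proof.
  intros H. induction n; simpl; [apply H; lia|].
  assert (0 <= f (S n)) by (apply H; lia).
  assert (0 <= sum_f_R0 f n) by (apply IHn; intros; apply H; lia). lra.
Qed.

Lemma sum_f_R0_le_wider (f : nat -> R) (m n : nat) :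
  (forall k, 0 <= f k) -> (m <= n)%nat -> sum_f_R0 f m <= sum_f_R0 f n.
Proof. intros Hf. induction 1; simpl; [lra|]. specialize (Hf (S m0)). lra. Qed.

Lemma term_le_sum_f_R0 (f : nat -> R) (k n : nat) :
  (forall j, (j <= n)%nat -> 0 <= f j) -> (k <= n)%nat -> f k <= sum_f_R0 f n.
Proof.
  intros Hf Hk. induction n; simpl.
  - replace k with 0%nat by lia. lra.
  - destruct (Nat.eq_dec k (S n)) as [->|E].
    + assert (0 <= sum_f_R0 f n) by (apply sum_f_R0_nonneg; intros; apply Hf; lia). lra.
    + assert (f k <= sum_f_R0 f n) by (apply IHn; [intros; apply Hf|]; lia).
      assert (0 <= f (S n)) by (apply Hf; lia). lra.
Qed.

Lemma sum_f_R0_scal (c : R) (f : nat -> R) (n : nat) :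
  sum_f_R0 (fun k => c * f k) n = c * sum_f_R0 f n.
Proof. rewrite scal_sum. apply sum_eq. intros. ring. Qed.

Lemma sum_f_R0_abs_le (f e : nat -> R) (n : nat) :
  (forall k, (k <= n)%nat -> Rabs (f k) <= e k) -> Rabs (sum_f_R0 f n) <= sum_f_R0 e n.
Proof.
  intros H. apply Rle_trans with (1 := Rsum_abs f n). apply sum_Rle. auto.
Qed.

(** * Rates and weighted sums *)

Definition prev (f : nat -> R) (k : nat) : R :=
  match k with O => 0 | S j => f j end.

(* The index is shifted by two: [x k] stands for [c (k + 2)], so that [prev]
   encodes the boundary condition [c 1 = 0]. *)
Definition drift (A B : nat -> R) (th : R) (x : nat -> R) (k : nat) : R :=
  prev (fun j => A j * th * x j) k - (A k * th + B k) * x k + B (S k) * x (S k).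

Definition mass (x : nat -> R) (m : nat) : R := sum_f_R0 (fun k => (INR k + 2) * x k) m.

Definition uptake (A x : nat -> R) (m : nat) : R := sum_f_R0 (fun k => A k * x k) m.

(* Clusters of size two release two monomers when they break up, hence the extra term. *)
Definition release (B x : nat -> R) (m : nat) : R :=
  sum_f_R0 (fun k => B k * x k) m + B 0%nat * x 0%nat.

(** Weak form of the equations against a test sequence [phi]. The two terms outside the sums account
    for the exchange between indices [n] and [S n]. *)
Lemma sum_drift_by_parts (A B : nat -> R) (th : R) (x phi : nat -> R) (n : nat) :
  sum_f_R0 (fun k => phi k * drift A B th x k) n =
  sum_f_R0 (fun k => A k * th * x k * (phi (S k) - phi k)) n
  - sum_f_R0 (fun k => B k * x k * (phi k - prev phi k)) n
  - phi (S n) * A n * th * x n + phi n * B (S n) * x (S n).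
Proof.
  induction n.
  - simpl. unfold drift. simpl. ring.
  - rewrite !tech5, IHn. unfold drift. simpl prev. ring.
Qed.

(** The only facts about the coefficients that the analysis uses. [r n] dominates
    [A k ^ 2 / (k + 2)] for all [k >= n]: [r 0] is a global constant, and [r n] measures what the
    sizes beyond [n] can contribute when the mass is at most 1. Increments of [A] are bounded by
    [A 0] to avoid one more constant. *)
Record rates (A B r : nat -> R) (beta : R) : Prop := {
  rates_A_pos : forall k, 0 < A k;
  rates_A_mono : forall k, A k <= A (S k);
  rates_A_incr : forall k, A (S k) <= A k + A 0%nat;
  rates_B_ge0 : forall k, 0 <= B k;
  rates_B_le : forall k, B k <= beta * A k;
  rates_A_sqr : forall n k, (n <= k)%nat -> A k * A k <= r n * (INR k + 2);
  rates_r_lim : is_lim_seq r 0 }.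

Section Kinetics.

Context {A B r : nat -> R} {beta : R} (HAB : rates A B r beta).

Lemma rates_beta_ge0 : 0 <= beta.
Proof.
  assert (a := rates_A_pos _ _ _ _ HAB 0%nat). assert (b := rates_B_ge0 _ _ _ _ HAB 0%nat).
  assert (c := rates_B_le _ _ _ _ HAB 0%nat).
  destruct (Rle_dec 0 beta) as [H|H]; [exact H|nra].
Qed.

Lemma rates_r_pos (n : nat) : 0 < r n.
Proof.
  assert (a := rates_A_pos _ _ _ _ HAB n). assert (b := rates_A_sqr _ _ _ _ HAB n n (le_n n)).
  assert (c := pos_INR n). destruct (Rlt_dec 0 (r n)) as [H|H]; [exact H|nra].
Qed.

Lemma rates_A_le (j k : nat) : (j <= k)%nat -> A j <= A k.
Proof. induction 1; [lra|]. assert (h := rates_A_mono _ _ _ _ HAB m). lra. Qed.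

(** Because [A 0 * A k <= A k ^ 2]. This is where the factor [/ A 0] of every defect bound comes
    from. *)
Lemma rates_A_sublinear (n k : nat) : (n <= k)%nat -> A k <= r n / A 0%nat * (INR k + 2).
Proof.
  intros H. assert (a := rates_A_pos _ _ _ _ HAB 0%nat).
  assert (b := rates_A_sqr _ _ _ _ HAB n k H). assert (c := rates_A_le 0 k (Nat.le_0_l k)).
  apply Rmult_le_reg_l with (A 0%nat); [exact a|].
  replace (A 0%nat * (r n / A 0%nat * (INR k + 2))) with (r n * (INR k + 2)) by (field; lra).
  nra.
Qed.

(** Shifting the index by one costs at most a factor 2, as [k + 3 <= 2 * (k + 2)]. *)
Lemma rates_A_sqr_succ (n k : nat) (y : R) : (n <= k)%nat -> 0 <= y ->
  A (S k) * A (S k) * y <= 2 * r n * ((INR k + 2) * y).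
Proof.
  intros H Hy. assert (b := rates_A_sqr _ _ _ _ HAB n (S k) ltac:(lia)). rewrite S_INR in b.
  assert (c := pos_INR k). assert (d := rates_r_pos n).
  apply Rle_trans with (r n * (INR k + 1 + 2) * y).
  - apply Rmult_le_compat_r; lra.
  - replace (2 * r n * ((INR k + 2) * y)) with (r n * (2 * (INR k + 2)) * y) by ring.
    apply Rmult_le_compat_r; [lra|]. apply Rmult_le_compat_l; lra.
Qed.

Lemma mass_term_le (x : nat -> R) (m k : nat) :
  (forall j, 0 <= x j) -> (k <= m)%nat -> mass x m <= 1 -> (INR k + 2) * x k <= 1.
Proof.
  intros Hx Hk Hm. apply Rle_trans with (2 := Hm). unfold mass.
  apply (term_le_sum_f_R0 (fun k => (INR k + 2) * x k)); auto.
  intros j _. assert (a := pos_INR j). specialize (Hx j). nra.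
Qed.

Lemma drift_sub (th th' : R) (x x' : nat -> R) (k : nat) :
  drift A B th x k - drift A B th' x' k =
  drift A B th (fun j => x j - x' j) k + (th - th') * drift A (fun _ => 0) 1 x' k.
Proof. unfold drift. destruct k; simpl; ring. Qed.

(* The source term costs [A (S k) ^ 2 * x' k], which the mass controls because
   [A ^ 2] grows sublinearly. *)
Lemma source_le (x' s : nat -> R) (n : nat) :
  (forall k, 0 <= x' k) -> mass x' n <= 1 -> (forall k, Rabs (s k) <= 1) ->
  Rabs (sum_f_R0 (fun k => A k * s k * drift A (fun _ => 0) 1 x' k) n) <= 6 * r 0%nat.
Proof.
  intros Hx Hm Hs.
  rewrite (sum_drift_by_parts A (fun _ => 0) 1 x' (fun k => A k * s k)).
  (* Each product met below is at most [A (S k) ^ 2 * x' k], hence [2 * r 0] times a mass term. Two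
     of them in the interior sum and one at the boundary make up the constant 6. *)
  assert (Hb : forall j k, (j <= S k)%nat -> Rabs (A k * x' k * (A j * s j)) <= A (S k) * A (S k) * x' k).
  { intros j k Hjk. rewrite !Rabs_mult.
    assert (a := rates_A_pos _ _ _ _ HAB k). assert (b := rates_A_pos _ _ _ _ HAB j).
    rewrite (Rabs_right (A k)), (Rabs_right (A j)), (Rabs_right (x' k))
      by (apply Rle_ge; auto; lra).
    assert (c := rates_A_mono _ _ _ _ HAB k). assert (d := rates_A_le j (S k) Hjk).
    specialize (Hs j). specialize (Hx k). assert (f := Rabs_pos (s j)).
    replace (A (S k) * A (S k) * x' k) with (A (S k) * x' k * (A (S k) * 1)) by ring.
    apply Rmult_le_compat; try nra. }
  assert (H0 : sum_f_R0 (fun k => 0 * x' k * (A k * s k - prev (fun j => A j * s j) k)) n = 0).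
  { transitivity (0 * sum_f_R0 (fun _ => 0) n); [|ring].
    rewrite <- sum_f_R0_scal. apply sum_eq. intros; ring. }
  rewrite H0.
  assert (H1 : Rabs (sum_f_R0 (fun k => A k * 1 * x' k * (A (S k) * s (S k) - A k * s k)) n)
               <= 4 * r 0%nat * mass x' n).
  { unfold mass. rewrite <- sum_f_R0_scal. apply sum_f_R0_abs_le. intros k _.
    assert (a := Hb (S k) k ltac:(lia)). assert (b := Hb k k ltac:(lia)).
    assert (c := rates_A_sqr_succ 0 k (x' k) ltac:(lia) (Hx k)).
    replace (A k * 1 * x' k * (A (S k) * s (S k) - A k * s k))
      with (A k * x' k * (A (S k) * s (S k)) - A k * x' k * (A k * s k)) by ring.
    apply Rabs_le_between in a. apply Rabs_le_between in b. apply Rabs_le. lra. }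
  assert (H2 : Rabs (A (S n) * s (S n) * A n * 1 * x' n) <= 2 * r 0%nat).
  { assert (a := Hb (S n) n ltac:(lia)).
    assert (c := rates_A_sqr_succ 0 n (x' n) ltac:(lia) (Hx n)).
    assert (d := mass_term_le x' n n Hx (le_n n) Hm). assert (e := rates_r_pos 0).
    replace (A (S n) * s (S n) * A n * 1 * x' n) with (A n * x' n * (A (S n) * s (S n))) by ring.
    nra. }
  assert (e := rates_r_pos 0).
  assert (H3 : 4 * r 0%nat * mass x' n <= 4 * r 0%nat) by nra.
  apply Rabs_le_between in H1. apply Rabs_le_between in H2. apply Rabs_le. lra.
Qed.

(** Here [s] is a smoothed sign of [e]. In the growth terms [s (S k) * e k <= |e k|] whereas
    [s k * e k >= |e k| - eps], so that the unbounded factors [A (S k)] and [A k] cancel up to the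
    increment, at most [A 0]. In the break-up terms the same comparison has a favourable sign, [A]
    being nondecreasing, and leaves only an error in [eps]. The exchange at [n] contributes
    [4 * beta * r n] for growth and [beta * r n] for break-up, by the pointwise decay of [e] that
    the mass gives. *)
Lemma transport_le (th eps : R) (e s : nat -> R) (n : nat) :
  0 <= th <= 2 * beta -> 0 <= eps ->
  (forall k, (INR k + 2) * Rabs (e k) <= 1) ->
  (forall k, Rabs (s k) <= 1) -> (forall k, Rabs (e k) - eps <= s k * e k) ->
  sum_f_R0 (fun k => A k * s k * drift A B th e k) n <=
  2 * beta * A 0%nat * sum_f_R0 (fun k => A k * Rabs (e k)) n
  + 5 * beta * r n + eps * (3 * beta * sum_f_R0 (fun k => A k * A k) n).
Proof.
  intros Hth Heps He Hs Hse. assert (Hbeta := rates_beta_ge0).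
  rewrite (sum_drift_by_parts A B th e (fun k => A k * s k)).
  assert (Hsign : forall j k, - Rabs (e k) <= s j * e k <= Rabs (e k)).
  { intros j k. assert (H : Rabs (s j * e k) <= Rabs (e k)).
    { rewrite Rabs_mult. assert (a := Rabs_pos (e k)). specialize (Hs j). nra. }
    apply Rabs_le_between in H. exact H. }
  assert (H1 : sum_f_R0 (fun k => A k * th * e k * (A (S k) * s (S k) - A k * s k)) n <=
     2 * beta * A 0%nat * sum_f_R0 (fun k => A k * Rabs (e k)) n
     + eps * (2 * beta * sum_f_R0 (fun k => A k * A k) n)).
  { rewrite <- !sum_f_R0_scal, <- sum_plus. apply sum_Rle. intros k _.
    assert (a := rates_A_pos _ _ _ _ HAB k). assert (b := rates_A_mono _ _ _ _ HAB k).
    assert (c := rates_A_incr _ _ _ _ HAB k). assert (a0 := rates_A_pos _ _ _ _ HAB 0%nat).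
    assert (s1 := Hsign (S k) k). assert (s2 := Hse k). assert (p := Rabs_pos (e k)).
    assert (X : e k * (A (S k) * s (S k) - A k * s k) <= A 0%nat * Rabs (e k) + A k * eps) by nra.
    replace (A k * th * e k * (A (S k) * s (S k) - A k * s k))
      with ((A k * th) * (e k * (A (S k) * s (S k) - A k * s k))) by ring.
    apply Rle_trans with (A k * th * (A 0%nat * Rabs (e k) + A k * eps)).
    - apply Rmult_le_compat_l; [nra|exact X].
    - replace (2 * beta * A 0%nat * (A k * Rabs (e k)) + eps * (2 * beta * (A k * A k)))
        with (A k * (2 * beta) * (A 0%nat * Rabs (e k) + A k * eps)) by ring.
      apply Rmult_le_compat_r; [nra|]. nra. }
  assert (H2 : - sum_f_R0 (fun k => B k * e k * (A k * s k - prev (fun j => A j * s j) k)) n <=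
     eps * (beta * sum_f_R0 (fun k => A k * A k) n)).
  { rewrite <- !sum_f_R0_scal.
    replace (- sum_f_R0 (fun k => B k * e k * (A k * s k - prev (fun j => A j * s j) k)) n)
      with (-1 * sum_f_R0 (fun k => B k * e k * (A k * s k - prev (fun j => A j * s j) k)) n) by ring.
    rewrite <- sum_f_R0_scal. apply sum_Rle. intros k _.
    assert (a := rates_A_pos _ _ _ _ HAB k).
    assert (b := rates_B_ge0 _ _ _ _ HAB k). assert (c := rates_B_le _ _ _ _ HAB k).
    assert (s2 := Hse k). assert (p := Rabs_pos (e k)).
    assert (X : - (e k * (A k * s k - prev (fun j => A j * s j) k)) <= A k * eps).
    { destruct k as [|k]; simpl prev.
      - nra.
      - assert (s1 := Hsign k (S k)). assert (m := rates_A_mono _ _ _ _ HAB k).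
        assert (a' := rates_A_pos _ _ _ _ HAB k). nra. }
    replace (-1 * (B k * e k * (A k * s k - prev (fun j => A j * s j) k)))
      with (B k * - (e k * (A k * s k - prev (fun j => A j * s j) k))) by ring.
    apply Rle_trans with (B k * (A k * eps)).
    - apply Rmult_le_compat_l; [exact b|exact X].
    - replace (eps * (beta * (A k * A k))) with (beta * A k * (A k * eps)) by ring.
      apply Rmult_le_compat_r; [nra|exact c]. }
  assert (a := rates_A_pos _ _ _ _ HAB n). assert (b := rates_A_mono _ _ _ _ HAB n).
  assert (rn := rates_r_pos n).
  assert (H3 : - (A (S n) * s (S n) * A n * th * e n) <= 4 * beta * r n).
  { assert (s1 := Hsign (S n) n). assert (p := Rabs_pos (e n)).
    assert (q := rates_A_sqr_succ n n (Rabs (e n)) (le_n n) p). specialize (He n).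
    assert (X : A (S n) * A n * Rabs (e n) <= 2 * r n).
    { apply Rle_trans with (A (S n) * A (S n) * Rabs (e n)); [|nra].
      apply Rmult_le_compat_r; [exact p|]. apply Rmult_le_compat_l; lra. }
    replace (- (A (S n) * s (S n) * A n * th * e n))
      with (th * (A (S n) * A n * - (s (S n) * e n))) by ring.
    apply Rle_trans with (th * (2 * r n)); [|nra].
    apply Rmult_le_compat_l; [lra|]. apply Rle_trans with (2 := X).
    apply Rmult_le_compat_l; [nra|lra]. }
  assert (H4 : A n * s n * B (S n) * e (S n) <= beta * r n).
  { assert (s1 := Hsign n (S n)). assert (p := Rabs_pos (e (S n))).
    assert (q := rates_A_sqr _ _ _ _ HAB n (S n) (le_S _ _ (le_n n))). specialize (He (S n)).
    assert (c := rates_B_ge0 _ _ _ _ HAB (S n)). assert (d := rates_B_le _ _ _ _ HAB (S n)).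
    assert (X : A (S n) * A (S n) * Rabs (e (S n)) <= r n).
    { apply Rle_trans with (r n * (INR (S n) + 2) * Rabs (e (S n))).
      - apply Rmult_le_compat_r; [exact p|exact q].
      - rewrite Rmult_assoc. rewrite <- (Rmult_1_r (r n)) at 2.
        apply Rmult_le_compat_l; lra. }
    apply Rle_trans with (A n * B (S n) * Rabs (e (S n))).
    - replace (A n * s n * B (S n) * e (S n)) with (A n * B (S n) * (s n * e (S n))) by ring.
      apply Rmult_le_compat_l; [nra|lra].
    - apply Rle_trans with (beta * (A (S n) * A (S n) * Rabs (e (S n)))); [|nra].
      rewrite <- Rmult_assoc. apply Rmult_le_compat_r; [exact p|].
      apply Rle_trans with (A (S n) * B (S n)); [nra|]. nra. }
  lra.
Qed.

(** The factor 2 pays for the size two term, which [release] counts twice. *)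
Lemma release_sub_le (x x' : nat -> R) (n : nat) :
  Rabs (release B x n - release B x' n) <=
  2 * beta * sum_f_R0 (fun k => A k * Rabs (x k - x' k)) n.
Proof.
  unfold release.
  assert (H1 : Rabs (sum_f_R0 (fun k => B k * x k) n - sum_f_R0 (fun k => B k * x' k) n)
     <= beta * sum_f_R0 (fun k => A k * Rabs (x k - x' k)) n).
  { rewrite <- minus_sum, <- sum_f_R0_scal. apply sum_f_R0_abs_le. intros k _.
    replace (B k * x k - B k * x' k) with (B k * (x k - x' k)) by ring.
    rewrite Rabs_mult, (Rabs_right (B k)) by (apply Rle_ge, (rates_B_ge0 _ _ _ _ HAB)).
    rewrite <- Rmult_assoc. apply Rmult_le_compat_r; [apply Rabs_pos|].
    apply (rates_B_le _ _ _ _ HAB). }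
  assert (H2 : Rabs (B 0%nat * x 0%nat - B 0%nat * x' 0%nat)
     <= beta * sum_f_R0 (fun k => A k * Rabs (x k - x' k)) n).
  { replace (B 0%nat * x 0%nat - B 0%nat * x' 0%nat)
      with (B 0%nat * (x 0%nat - x' 0%nat)) by ring.
    rewrite Rabs_mult, (Rabs_right (B 0%nat)) by (apply Rle_ge, (rates_B_ge0 _ _ _ _ HAB)).
    apply Rle_trans with (beta * (A 0%nat * Rabs (x 0%nat - x' 0%nat))).
    - rewrite <- Rmult_assoc. apply Rmult_le_compat_r; [apply Rabs_pos|].
      apply (rates_B_le _ _ _ _ HAB).
    - apply Rmult_le_compat_l; [apply rates_beta_ge0|].
      apply (term_le_sum_f_R0 (fun k => A k * Rabs (x k - x' k))); [|lia].
      intros j _. apply Rmult_le_pos; [left; apply (rates_A_pos _ _ _ _ HAB)|apply Rabs_pos]. }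
  apply Rabs_le_between in H1. apply Rabs_le_between in H2. apply Rabs_le. lra.
Qed.

Lemma uptake_sub_le (x x' : nat -> R) (n : nat) :
  Rabs (uptake A x n - uptake A x' n) <= sum_f_R0 (fun k => A k * Rabs (x k - x' k)) n.
Proof.
  unfold uptake. rewrite <- minus_sum. apply sum_f_R0_abs_le. intros k _.
  replace (A k * x k - A k * x' k) with (A k * (x k - x' k)) by ring.
  rewrite Rabs_mult, (Rabs_right (A k)) by (apply Rle_ge; left; apply (rates_A_pos _ _ _ _ HAB)).
  lra.
Qed.

(* [(th - th') * D' = (N - N') - th * (D - D')] up to the defects, with [D] the uptake
   and [N] the release. *)
Lemma monomer_sub_uptake_le (th th' rho : R) (x x' : nat -> R) (n : nat) :
  0 <= th <= 2 * beta -> (forall k, 0 <= x' k) ->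
  Rabs (th * uptake A x n - release B x n) <= rho ->
  Rabs (th' * uptake A x' n - release B x' n) <= rho ->
  Rabs (th - th') * uptake A x' n <=
  4 * beta * sum_f_R0 (fun k => A k * Rabs (x k - x' k)) n + 2 * rho.
Proof.
  intros Hth Hx H1 H2.
  assert (HD : 0 <= uptake A x' n).
  { apply sum_f_R0_nonneg. intros k _. apply Rmult_le_pos; [left; apply (rates_A_pos _ _ _ _ HAB)|auto]. }
  assert (H3 := uptake_sub_le x x' n). assert (H4 := release_sub_le x x' n).
  set (Sm := sum_f_R0 (fun k => A k * Rabs (x k - x' k)) n) in *.
  assert (HS : 0 <= Sm) by (assert (a := Rabs_pos (uptake A x n - uptake A x' n)); lra).
  rewrite <- (Rabs_right (uptake A x' n)) at 1 by lra. rewrite <- Rabs_mult.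
  assert (H5 : Rabs (th * (uptake A x n - uptake A x' n)) <= 2 * beta * Sm).
  { rewrite Rabs_mult, (Rabs_right th) by lra. apply Rmult_le_compat; try apply Rabs_pos; lra. }
  apply Rabs_le_between in H1. apply Rabs_le_between in H2. apply Rabs_le_between in H4.
  apply Rabs_le_between in H5.
  apply Rabs_le. nra.
Qed.
End Kinetics.

(** * Stability *)

(** The weighted norm of a difference is not differentiable where a component vanishes. This
    smoothing is, and [eps] is sent to 0 in [approx_stable] while the truncation index is fixed. *)
Definition smooth_abs (eps y : R) : R := sqrt (y * y + eps * eps).

Lemma smooth_abs_pos (eps y : R) : 0 < eps -> 0 < smooth_abs eps y.
Proof. intros H. apply sqrt_lt_R0. nra. Qed.

Lemma smooth_abs_sqr (eps y : R) :
  smooth_abs eps y * smooth_abs eps y = y * y + eps * eps.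
Proof. apply sqrt_sqrt. nra. Qed.

Lemma Rabs_le_smooth_abs (eps y : R) : Rabs y <= smooth_abs eps y.
Proof.
  rewrite <- sqrt_Rsqr_abs. apply sqrt_le_1_alt. unfold Rsqr. nra.
Qed.

Lemma smooth_abs_le (eps y : R) : 0 < eps -> smooth_abs eps y <= Rabs y + eps.
Proof.
  intros H. assert (a := smooth_abs_sqr eps y). assert (b := smooth_abs_pos eps y H).
  assert (c := Rabs_pos y). assert (d : Rabs y * Rabs y = y * y).
  { rewrite <- Rabs_mult. apply Rabs_right. nra. }
  nra.
Qed.

Lemma is_derive_smooth_abs (eps y : R) :
  0 < eps -> is_derive (smooth_abs eps) y (y / smooth_abs eps y).
Proof.
  intros H. unfold smooth_abs. auto_derive.
  - nra.
  - field. apply Rgt_not_eq, sqrt_lt_R0. nra.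
Qed.

Lemma smooth_sign_le (eps y : R) : 0 < eps -> Rabs (y / smooth_abs eps y) <= 1.
Proof.
  intros H. assert (b := smooth_abs_pos eps y H).
  unfold Rdiv. rewrite Rabs_mult, (Rabs_right (/ _)).
  - apply Rmult_le_reg_r with (smooth_abs eps y); [exact b|].
    rewrite Rmult_assoc, Rinv_l, Rmult_1_l, Rmult_1_r by lra. apply Rabs_le_smooth_abs.
  - left. apply Rinv_0_lt_compat, b.
Qed.

(** When [|y| > eps], multiply by the denominator, which is at most [|y| + eps], and use
    [(|y| - eps) * (|y| + eps) <= y^2]; otherwise the left side is at most 0. *)
Lemma smooth_sign_mul_ge (eps y : R) : 0 < eps -> Rabs y - eps <= y / smooth_abs eps y * y.
Proof.
  intros H. assert (b := smooth_abs_pos eps y H). assert (a := smooth_abs_sqr eps y).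
  assert (c := smooth_abs_le eps y H).
  apply Rmult_le_reg_r with (smooth_abs eps y); [exact b|].
  replace (y / smooth_abs eps y * y * smooth_abs eps y) with (y * y) by (field; lra).
  assert (d : Rabs y * Rabs y = y * y).
  { rewrite <- Rabs_mult. apply Rabs_right. nra. }
  destruct (Rle_dec (Rabs y) eps); nra.
Qed.

(** Common interface of exact solutions (all [n]) and of solutions truncated at [n]. The index [n]
    enters only through the equations and the initial data, so a solution for a larger index is one
    for [n]. The defect clause is the conservation law read on the first [m] sizes; its constant is
    [2 * (th + beta) / A 0] at the largest admissible [th = 2 * beta]. *)
Record approx (A B r : nat -> R) (beta : R) (gamma : nat -> R) (n : nat)
    (th : R -> R) (x : nat -> R -> R) : Prop := {
  approx_th_bound : forall t, 0 <= t -> 0 <= th t <= 2 * beta;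
  approx_th_cont : forall t, continuous th t;
  approx_ge0 : forall k t, 0 <= t -> 0 <= x k t;
  approx_cont : forall k t, continuous (x k) t;
  approx_mass : forall m t, 0 <= t -> mass (fun k => x k t) m <= 1;
  approx_ode : forall k t, (k <= n)%nat -> 0 < t ->
    is_derive (x k) t (drift A B (th t) (fun j => x j t) k);
  approx_defect : forall m t, 0 <= t ->
    Rabs (th t * uptake A (fun k => x k t) m - release B (fun k => x k t) m)
    <= 6 * beta / A 0%nat * r m;
  approx_initial : forall k, (k <= n)%nat -> x k 0 = gamma k }.

Lemma approx_weaken A B r beta gamma m n th x :
  (m <= n)%nat -> approx A B r beta gamma n th x -> approx A B r beta gamma m th x.
Proof.
  intros H [H1 H2 H3 H4 H5 H6 H7 H8]. split; auto.
  - intros k t Hk. apply H6. lia.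
  - intros k Hk. apply H8. lia.
Qed.

Section Stability.

Context {A B r : nat -> R} {beta : R} (HAB : rates A B r beta) (gamma : nat -> R).

(** Only the loss terms can decrease [x k], and their rate is at most [2 * beta * A k + B k]. *)
Lemma approx_lower_bound (n k : nat) (th : R -> R) (x : nat -> R -> R) (t : R) :
  approx A B r beta gamma n th x -> (k <= n)%nat -> 0 <= t ->
  gamma k * exp (- (2 * beta * A k + B k) * t) <= x k t.
Proof.
  intros H Hk Ht. set (Lam := 2 * beta * A k + B k).
  assert (E : (fun s => - (exp (Lam * s) * x k s)) t <= (fun s => - (exp (Lam * s) * x k s)) 0).
  { apply (le_initial_of_derive_nonpos (fun s => - (exp (Lam * s) * x k s))
      (fun s => - (Lam * exp (Lam * s) * x k s
         + exp (Lam * s) * drift A B (th s) (fun j => x j s) k)) (t + 1)); [| | |lra].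
    - intros s. apply (continuous_opp (fun s => exp (Lam * s) * x k s)).
      apply (continuous_mult (fun s => exp (Lam * s)) (x k)).
      apply continuous_exp_scal. apply (approx_cont _ _ _ _ _ _ _ _ H).
    - intros s Hs. apply (is_derive_opp (fun s => exp (Lam * s) * x k s)).
      apply (is_derive_mult (fun s => exp (Lam * s)) (x k)).
      apply is_derive_exp_scal. apply (approx_ode _ _ _ _ _ _ _ _ H); [exact Hk|lra].
      intros; apply Rmult_comm.
    - intros s Hs. assert (P := exp_pos (Lam * s)).
      assert (a := approx_th_bound _ _ _ _ _ _ _ _ H s ltac:(lra)).
      assert (G : forall j, 0 <= x j s) by (intros; apply (approx_ge0 _ _ _ _ _ _ _ _ H); lra).
      assert (Ap := rates_A_pos _ _ _ _ HAB). assert (Bp := rates_B_ge0 _ _ _ _ HAB).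
      assert (X : - (Lam * x k s) <= drift A B (th s) (fun j => x j s) k).
      { unfold drift.
        assert (Y1 : 0 <= prev (fun j => A j * th s * x j s) k).
        { destruct k as [|j]; simpl; [lra|]. specialize (Ap j). specialize (G j).
          apply Rmult_le_pos; [nra|exact G]. }
        assert (Y2 : 0 <= B (S k) * x (S k) s) by (apply Rmult_le_pos; auto).
        assert (Y3 : (A k * th s + B k) * x k s <= Lam * x k s).
        { apply Rmult_le_compat_r; [apply G|]. unfold Lam. specialize (Ap k). nra. }
        lra. }
      nra. }
  simpl in E. rewrite Rmult_0_r, exp_0, Rmult_1_l, (approx_initial _ _ _ _ _ _ _ _ H) in E by exact Hk.
  assert (P := exp_pos (- Lam * t)).
  assert (Ex : exp (- Lam * t) * exp (Lam * t) = 1).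
  { rewrite <- exp_plus. replace (- Lam * t + Lam * t) with 0 by ring. apply exp_0. }
  replace (x k t) with (exp (- Lam * t) * (exp (Lam * t) * x k t)).
  - rewrite Rmult_comm. apply Rmult_le_compat_l; lra.
  - rewrite <- Rmult_assoc, Ex. ring.
Qed.

(** One initially populated size already gives a lower bound that does not depend on [n]. It is what
    allows dividing by the uptake to compare two values of [th]. *)
Lemma approx_uptake_lower_bound (n k : nat) (th : R -> R) (x : nat -> R -> R) (t T : R) :
  approx A B r beta gamma n th x -> (k <= n)%nat -> 0 <= gamma k -> 0 <= t <= T ->
  A k * gamma k * exp (- (2 * beta * A k + B k) * T) <= uptake A (fun j => x j t) n.
Proof.
  intros H Hk Hg Ht.
  assert (a := approx_lower_bound n k th x t H Hk ltac:(lra)).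
  assert (Ap := rates_A_pos _ _ _ _ HAB k). assert (Bp := rates_B_ge0 _ _ _ _ HAB k).
  assert (hb := rates_beta_ge0 HAB).
  apply Rle_trans with (A k * x k t).
  - rewrite Rmult_assoc. apply Rmult_le_compat_l; [lra|]. apply Rle_trans with (2 := a).
    apply Rmult_le_compat_l; [exact Hg|].
    assert (X : - (2 * beta * A k + B k) * T <= - (2 * beta * A k + B k) * t).
    { assert (0 <= 2 * beta * A k) by nra. nra. }
    destruct X as [X|X]; [left; apply exp_increasing, X|rewrite X; lra].
  - apply (term_le_sum_f_R0 (fun j => A j * x j t)); [|exact Hk].
    intros j _. apply Rmult_le_pos; [left; apply (rates_A_pos _ _ _ _ HAB)|].
    apply (approx_ge0 _ _ _ _ _ _ _ _ H). lra.
Qed.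

Lemma approx_term_le (n k : nat) (th : R -> R) (x : nat -> R -> R) (t : R) :
  approx A B r beta gamma n th x -> 0 <= t -> (INR k + 2) * x k t <= 1.
Proof.
  intros H Ht. apply (mass_term_le (fun j => x j t) k k); auto.
  - intros j. apply (approx_ge0 _ _ _ _ _ _ _ _ H j t Ht).
  - apply (approx_mass _ _ _ _ _ _ _ _ H k t Ht).
Qed.

(** Gronwall for the smoothed norm. By [monomer_sub_uptake_le], [|th - th'| * d] is at most
    [4 * beta] times the norm plus two defects, that is [12 * beta / A 0 * r n]. The source
    multiplies this by [6 * r 0], whence 24 and 72; the term [5 * beta] is the boundary exchange of
    [transport_le]. *)
Lemma approx_smooth_dist_le (d eps T : R) (n : nat)
    (th th' : R -> R) (x x' : nat -> R -> R) :
  approx A B r beta gamma n th x -> approx A B r beta gamma n th' x' ->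
  0 < d -> 0 < eps ->
  (forall t, 0 <= t <= T -> d <= uptake A (fun k => x' k t) n) ->
  forall t, 0 <= t <= T ->
  sum_f_R0 (fun k => A k * Rabs (x k t - x' k t)) n <=
  exp ((2 * beta * A 0%nat + 24 * beta * r 0%nat / d) * t) *
  (eps * sum_f_R0 A n +
   ((5 * beta + 72 * beta * r 0%nat / (A 0%nat * d)) * r n
    + eps * (3 * beta * sum_f_R0 (fun k => A k * A k) n)) * t).
Proof.
  intros H H' Hd Heps HD t Ht.
  assert (hb := rates_beta_ge0 HAB). assert (hr := rates_r_pos HAB).
  assert (Ap := rates_A_pos _ _ _ _ HAB). assert (A0 := Ap 0%nat). assert (r0 := hr 0%nat).
  set (e := fun k t => x k t - x' k t).
  set (E := fun t => sum_f_R0 (fun k => A k * smooth_abs eps (e k t)) n).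
  set (K := 2 * beta * A 0%nat + 24 * beta * r 0%nat / d).
  set (M := (5 * beta + 72 * beta * r 0%nat / (A 0%nat * d)) * r n
    + eps * (3 * beta * sum_f_R0 (fun k => A k * A k) n)).
  assert (HK : 0 <= K).
  { unfold K. apply Rplus_le_le_0_compat; [nra|].
    apply Rdiv_le_0_compat; [nra|exact Hd]. }
  assert (HM : 0 <= M).
  { unfold M. apply Rplus_le_le_0_compat.
    - apply Rmult_le_pos; [|left; apply hr]. apply Rplus_le_le_0_compat; [lra|].
      apply Rdiv_le_0_compat; nra.
    - apply Rmult_le_pos; [lra|]. apply Rmult_le_pos; [lra|].
      apply sum_f_R0_nonneg. intros k _. specialize (Ap k). nra. }
  assert (Hsum : forall t, sum_f_R0 (fun k => A k * Rabs (x k t - x' k t)) n <= E t).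
  { intros s. apply sum_Rle. intros k _. apply Rmult_le_compat_l; [left; apply Ap|].
    apply Rabs_le_smooth_abs. }
  apply Rle_trans with (1 := Hsum t).
  assert (HE0 : E 0 = eps * sum_f_R0 A n).
  { unfold E. rewrite <- sum_f_R0_scal. apply sum_eq. intros k Hk. unfold e.
    rewrite (approx_initial _ _ _ _ _ _ _ _ H k Hk), (approx_initial _ _ _ _ _ _ _ _ H' k Hk).
    unfold smooth_abs. replace ((gamma k - gamma k) * (gamma k - gamma k) + eps * eps)
      with (eps * eps) by ring. rewrite sqrt_square by lra. ring. }
  rewrite <- HE0.
  set (s := fun t k => e k t / smooth_abs eps (e k t)).
  set (de := fun k t => drift A B (th t) (fun j => x j t) k - drift A B (th' t) (fun j => x' j t) k).
  apply (gronwall E (fun t => sum_f_R0 (fun k => A k * (s t k * de k t)) n) K M T); auto.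
  - intros u. apply (continuous_sum_f_R0 (fun k t => A k * smooth_abs eps (e k t))).
    intros k _. apply (continuous_mult (fun _ => A k) (fun t => smooth_abs eps (e k t))).
    apply continuous_const.
    apply (continuous_comp (e k) (smooth_abs eps)).
    + apply (continuous_minus (x k) (x' k)); [apply (approx_cont _ _ _ _ _ _ _ _ H)|apply (approx_cont _ _ _ _ _ _ _ _ H')].
    + apply (ex_derive_continuous (smooth_abs eps)). eexists. apply is_derive_smooth_abs, Heps.
  - intros u Hu.
    apply (is_derive_sum_f_R0 (fun k t => A k * smooth_abs eps (e k t))
      (fun k t => A k * (s t k * de k t))).
    intros k Hk.
    assert (D1 : is_derive (e k) u (de k u)).
    { apply (is_derive_minus (x k) (x' k));
       [apply (approx_ode _ _ _ _ _ _ _ _ H)|apply (approx_ode _ _ _ _ _ _ _ _ H')]; try exact Hk; lra. }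
    apply (is_derive_scal (fun t => smooth_abs eps (e k t))).
    replace (s u k * de k u) with (de k u * s u k) by ring.
    apply (is_derive_comp (smooth_abs eps) (e k)); [apply is_derive_smooth_abs, Heps|exact D1].
  - intros u Hu.
    assert (He : forall k, (INR k + 2) * Rabs (e k u) <= 1).
    { intros k. assert (p := approx_term_le n k th x u H ltac:(lra)).
      assert (p' := approx_term_le n k th' x' u H' ltac:(lra)).
      assert (q := approx_ge0 _ _ _ _ _ _ _ _ H k u ltac:(lra)).
      assert (q' := approx_ge0 _ _ _ _ _ _ _ _ H' k u ltac:(lra)).
      assert (i := pos_INR k). unfold e, Rabs. destruct Rcase_abs; nra. }
    assert (Hs : forall k, Rabs (s u k) <= 1) by (intros k; apply smooth_sign_le, Heps).
    assert (Hse : forall k, Rabs (e k u) - eps <= s u k * e k u)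
      by (intros k; apply smooth_sign_mul_ge, Heps).
    assert (T1 := transport_le HAB (th u) eps (fun k => e k u) (s u) n
       (approx_th_bound _ _ _ _ _ _ _ _ H u ltac:(lra)) ltac:(lra) He Hs Hse).
    assert (G' : forall k, 0 <= x' k u) by (intros; apply (approx_ge0 _ _ _ _ _ _ _ _ H'); lra).
    assert (T2 := source_le HAB (fun k => x' k u) (s u) n G'
       (approx_mass _ _ _ _ _ _ _ _ H' n u ltac:(lra)) Hs).
    assert (T3 := monomer_sub_uptake_le HAB (th u) (th' u) (6 * beta / A 0%nat * r n)
       (fun k => x k u) (fun k => x' k u) n
       (approx_th_bound _ _ _ _ _ _ _ _ H u ltac:(lra)) G'
       (approx_defect _ _ _ _ _ _ _ _ H n u ltac:(lra))
       (approx_defect _ _ _ _ _ _ _ _ H' n u ltac:(lra))).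
    specialize (HD u ltac:(lra)). assert (HS := Hsum u).
    change (sum_f_R0 (fun k => A k * Rabs (x k u - x' k u)) n)
      with (sum_f_R0 (fun k => A k * Rabs (e k u)) n) in *.
    set (Sm := sum_f_R0 (fun k => A k * Rabs (e k u)) n) in *.
    set (src := sum_f_R0 (fun k => A k * s u k * drift A (fun _ => 0) 1 (fun j => x' j u) k) n) in *.
    (* The difference of the two drifts is the drift of [e] with coefficient [th], plus [th - th']
       times pure growth of [x']. The first part keeps its sign structure, and the second needs only
       moments of the single solution [x']. *)
    replace (sum_f_R0 (fun k => A k * (s u k * de k u)) n) with
      (sum_f_R0 (fun k => A k * s u k * drift A B (th u) (fun j => e j u) k) n + (th u - th' u) * src).
    2: { unfold src. rewrite <- sum_f_R0_scal, <- sum_plus. apply sum_eq. intros k _.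
         unfold de. rewrite drift_sub. unfold e. ring. }
    assert (T4 : Rabs (th u - th' u) * d <= 4 * beta * Sm + 2 * (6 * beta / A 0%nat * r n)).
    { apply Rle_trans with (2 := T3). apply Rmult_le_compat_l; [apply Rabs_pos|exact HD]. }
    assert (T5 : (th u - th' u) * src <= 24 * beta * r 0%nat / d * Sm
                 + 72 * beta * r 0%nat / (A 0%nat * d) * r n).
    { apply Rle_trans with (Rabs (th u - th' u) * (6 * r 0%nat)).
      - apply Rle_trans with (1 := Rle_abs _). rewrite Rabs_mult.
        apply Rmult_le_compat_l; [apply Rabs_pos|exact T2].
      - apply Rmult_le_reg_r with d; [exact Hd|].
        apply Rle_trans with ((4 * beta * Sm + 2 * (6 * beta / A 0%nat * r n)) * (6 * r 0%nat)).
        + rewrite Rmult_assoc, (Rmult_comm (6 * r 0%nat)), <- Rmult_assoc.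
          apply Rmult_le_compat_r; [lra|exact T4].
        + right. field. lra. }
    assert (T6 : K * Sm <= K * E u) by (apply Rmult_le_compat_l; [exact HK|exact HS]).
    unfold K, M in *. lra.
Qed.

(** The point is that [C] is chosen before [n] and the two solutions. *)
Lemma approx_stable (k0 : nat) (T : R) :
  0 < gamma k0 -> 0 <= T ->
  exists C, 0 < C /\
    forall n th x th' x', (k0 <= n)%nat ->
    approx A B r beta gamma n th x -> approx A B r beta gamma n th' x' ->
    forall t, 0 <= t <= T ->
    sum_f_R0 (fun k => A k * Rabs (x k t - x' k t)) n <= C * r n /\
    Rabs (th t - th' t) <= C * r n.
Proof.
  intros Hg HT.
  assert (hb := rates_beta_ge0 HAB). assert (hr := rates_r_pos HAB).
  assert (Ap := rates_A_pos _ _ _ _ HAB). assert (A0 := Ap 0%nat). assert (r0 := hr 0%nat).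
  set (d := A k0 * gamma k0 * exp (- (2 * beta * A k0 + B k0) * T)).
  assert (Hd : 0 < d).
  { unfold d. apply Rmult_lt_0_compat; [|apply exp_pos]. apply Rmult_lt_0_compat; auto. }
  set (K := 2 * beta * A 0%nat + 24 * beta * r 0%nat / d).
  set (M0 := 5 * beta + 72 * beta * r 0%nat / (A 0%nat * d)).
  assert (HK : 0 <= K).
  { unfold K. apply Rplus_le_le_0_compat; [nra|]. apply Rdiv_le_0_compat; [nra|exact Hd]. }
  assert (HM0 : 0 <= M0).
  { unfold M0. apply Rplus_le_le_0_compat; [lra|]. apply Rdiv_le_0_compat; nra. }
  set (C1 := exp (K * T) * (M0 * T)).
  assert (HC1 : 0 <= C1).
  { unfold C1. assert (p := exp_pos (K * T)). assert (0 <= M0 * T) by nra. nra. }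
  set (C2 := (4 * beta * C1 + 12 * beta / A 0%nat) / d).
  assert (HC2 : 0 <= C2).
  { unfold C2. apply Rdiv_le_0_compat; [|exact Hd]. apply Rplus_le_le_0_compat; [nra|].
    apply Rdiv_le_0_compat; nra. }
  exists (C1 + C2 + 1). split; [lra|].
  intros n th x th' x' Hn H H' t Ht.
  assert (rn := hr n).
  assert (HD : forall t, 0 <= t <= T -> d <= uptake A (fun k => x' k t) n).
  { intros u Hu. apply (approx_uptake_lower_bound n k0 th' x' u T); auto. lra. }
  (* The sums in [c0] grow with [n], but they only occur multiplied by the smoothing parameter,
     which tends to 0 for fixed [n]. *)
  assert (S1 : sum_f_R0 (fun k => A k * Rabs (x k t - x' k t)) n <= C1 * r n).
  { set (c0 := sum_f_R0 A n + 3 * beta * sum_f_R0 (fun k => A k * A k) n * T).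
    assert (Hsa : 0 <= sum_f_R0 A n) by (apply sum_f_R0_nonneg; intros; left; apply Ap).
    assert (Hsa2 : 0 <= sum_f_R0 (fun k => A k * A k) n).
    { apply sum_f_R0_nonneg; intros k _. specialize (Ap k). nra. }
    assert (Hc0 : 0 <= c0).
    { unfold c0. apply Rplus_le_le_0_compat; [exact Hsa|].
      apply Rmult_le_pos; [|exact HT]. apply Rmult_le_pos; [lra|exact Hsa2]. }
    set (c := exp (K * T) * c0).
    assert (Hc : 0 <= c) by (apply Rmult_le_pos; [left; apply exp_pos|exact Hc0]).
    apply le_epsilon. intros eps Heps.
    set (ep := eps / (c + 1)).
    assert (Hep : 0 < ep) by (apply Rdiv_lt_0_compat; lra).
    apply Rle_trans with (1 := approx_smooth_dist_le d ep T n th th' x x' H H' Hd Hep HD t Ht).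
    fold K. fold M0.
    apply Rle_trans with (exp (K * T) * (M0 * T * r n + ep * c0)).
    - apply Rmult_le_compat.
      + left; apply exp_pos.
      + apply Rplus_le_le_0_compat; [nra|]. apply Rmult_le_pos; [|lra].
        apply Rplus_le_le_0_compat; [nra|]. apply Rmult_le_pos; [lra|]. nra.
      + assert (X : K * t <= K * T) by nra.
        destruct X as [X|X]; [left; apply exp_increasing, X|rewrite X; lra].
      + unfold c0.
        assert (X1 : M0 * r n * t <= M0 * r n * T) by (apply Rmult_le_compat_l; [nra|lra]).
        assert (X2 : ep * (3 * beta * sum_f_R0 (fun k => A k * A k) n) * t
                  <= ep * (3 * beta * sum_f_R0 (fun k => A k * A k) n) * T).
        { apply Rmult_le_compat_l; [|lra]. apply Rmult_le_pos; [lra|]. nra. }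
        lra.
    - replace (exp (K * T) * (M0 * T * r n + ep * c0)) with (C1 * r n + ep * c)
        by (unfold C1, c; ring).
      apply Rplus_le_compat_l. apply Rle_trans with (ep * (c + 1)); [nra|].
      right. unfold ep. field. lra. }
  split.
  - nra.
  - assert (T3 := monomer_sub_uptake_le HAB (th t) (th' t) (6 * beta / A 0%nat * r n)
       (fun k => x k t) (fun k => x' k t) n
       (approx_th_bound _ _ _ _ _ _ _ _ H t ltac:(lra))
       (fun k => approx_ge0 _ _ _ _ _ _ _ _ H' k t ltac:(lra))
       (approx_defect _ _ _ _ _ _ _ _ H n t ltac:(lra))
       (approx_defect _ _ _ _ _ _ _ _ H' n t ltac:(lra))).
    specialize (HD t Ht).
    assert (X : Rabs (th t - th' t) <= C2 * r n).
    { apply Rmult_le_reg_r with d; [exact Hd|].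
      apply Rle_trans with (Rabs (th t - th' t) * uptake A (fun k => x' k t) n).
      - apply Rmult_le_compat_l; [apply Rabs_pos|exact HD].
      - apply Rle_trans with (1 := T3).
        replace (C2 * r n * d) with (4 * beta * (C1 * r n) + 2 * (6 * beta / A 0%nat * r n))
          by (unfold C2; field; lra).
        apply Rplus_le_compat_r. apply Rmult_le_compat_l; [lra|exact S1]. }
    nra.
Qed.

End Stability.

(** * Cauchy-Lipschitz theorem *)

Lemma is_lim_seq_cauchy_rate (a b : nat -> R) (N0 : nat) :
  (forall N m, (N0 <= N <= m)%nat -> Rabs (a m - a N) <= b N) ->
  is_lim_seq b 0 ->
  is_lim_seq a (real (Lim_seq a)) /\
  forall N, (N0 <= N)%nat -> Rabs (a N - real (Lim_seq a)) <= b N.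
Proof.
  intros Hab Hb.
  assert (Hex : ex_finite_lim_seq a).
  { apply ex_lim_seq_cauchy_corr. intros eps.
    apply is_lim_seq_spec in Hb. destruct (Hb (pos_div_2 eps)) as [N1 HN1].
    set (N := Nat.max N0 N1). exists N.
    assert (X := HN1 N ltac:(lia)). simpl in X. rewrite Rminus_0_r in X.
    apply Rabs_lt_between in X. intros p q Hp Hq.
    assert (Y := Hab N p ltac:(lia)). assert (Z := Hab N q ltac:(lia)).
    apply Rabs_le_between in Y. apply Rabs_le_between in Z. apply Rabs_lt_between. lra. }
  assert (Hl := Lim_seq_correct' a Hex). split; [exact Hl|].
  intros N HN. rewrite Rabs_minus_sym.
  apply is_lim_seq_abs_le with a N; [exact Hl|]. intros m Hm. apply Hab. lia.
Qed.

Lemma is_derive_Rmax0 (F : R -> R) (t l : R) :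
  0 < t -> is_derive F t l -> is_derive (fun s => F (Rmax 0 s)) t l.
Proof.
  intros Ht H. apply is_derive_ext_loc with (2 := H).
  exists (mkposreal t Ht). intros s Hs.
  change (Rabs (s - t) < t) in Hs. apply Rabs_lt_between in Hs.
  rewrite Rmax_right by lra. reflexivity.
Qed.

Lemma sum_f_R0_le_const (f : nat -> R) (c : R) (n : nat) :
  (forall k, (k <= n)%nat -> f k <= c) -> sum_f_R0 f n <= INR (S n) * c.
Proof.
  intros H. rewrite Rmult_comm, <- (sum_cte c). apply sum_Rle. exact H.
Qed.

Fixpoint picard (G : (nat -> R) -> nat -> R) (g : nat -> R) (j k : nat) (t : R) : R :=
  match j with
  | O => g k
  | S i => g k + RInt (fun s => G (fun l => picard G g i l s) k) 0 t
  end.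

Section Picard.

Context (n : nat) (G : (nat -> R) -> nat -> R) (L : R) (HL : 0 < L)
  (HG : forall u v k, (k <= n)%nat ->
     Rabs (G u k - G v k) <= L * sum_f_R0 (fun j => Rabs (u j - v j)) n)
  (g : nat -> R).

Lemma continuous_lipschitz_comp (u : nat -> R -> R) (k : nat) (t : R) :
  (k <= n)%nat -> (forall j, (j <= n)%nat -> continuous (u j) t) ->
  continuous (fun s => G (fun j => u j s) k) t.
Proof.
  intros Hk Hu. apply continuous_eps. intros eps He.
  assert (Hc : continuous (fun s => sum_f_R0 (fun j => Rabs (u j s - u j t)) n) t).
  { apply (continuous_sum_f_R0 (fun j s => Rabs (u j s - u j t))). intros j Hj.
    apply (continuous_comp (fun s => u j s - u j t) Rabs).
    - apply (continuous_minus (u j) (fun _ => u j t)); [auto|apply continuous_const].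
    - apply continuous_Rabs. }
  rewrite continuous_eps in Hc. destruct (Hc (eps / L)) as [d [Hd H]].
  { apply Rdiv_lt_0_compat; lra. }
  exists d. split; [exact Hd|]. intros s Hs. specialize (H s Hs).
  assert (E0 : sum_f_R0 (fun j => Rabs (u j t - u j t)) n = 0).
  { transitivity (0 * sum_f_R0 (fun _ => 0) n); [|ring]. rewrite <- sum_f_R0_scal.
    apply sum_eq. intros j _. rewrite Rminus_diag, Rabs_R0. ring. }
  rewrite E0, Rminus_0_r in H.
  apply Rle_lt_trans with (1 := HG _ _ _ Hk).
  apply Rabs_lt_between in H.
  apply Rmult_lt_reg_l with (/ L); [apply Rinv_0_lt_compat; lra|].
  rewrite <- Rmult_assoc, Rinv_l, Rmult_1_l by lra.
  rewrite Rmult_comm. apply H.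
Qed.

Lemma continuous_picard (j k : nat) (t : R) : (k <= n)%nat -> continuous (picard G g j k) t.
Proof.
  revert k t. induction j as [|j IH]; intros k t Hk.
  - apply continuous_const.
  - apply (continuous_plus (fun _ => g k)); [apply continuous_const|].
    apply (ex_derive_continuous (fun t => RInt (fun s => G (fun l => picard G g j l s) k) 0 t)).
    eexists. apply is_derive_primitive. intros s. apply continuous_lipschitz_comp; auto.
Qed.

Lemma is_derive_picard (j k : nat) (t : R) : (k <= n)%nat ->
  is_derive (picard G g (S j) k) t (G (fun l => picard G g j l t) k).
Proof.
  intros Hk. rewrite <- (Rplus_0_l (G _ k)).
  apply (is_derive_plus (fun _ => g k)); [apply @is_derive_const|].
  apply (is_derive_primitive (fun s => G (fun l => picard G g j l s) k)).
  intros s. apply continuous_lipschitz_comp; [exact Hk|].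
  intros; apply continuous_picard; auto.
Qed.

Lemma picard_initial (j k : nat) : picard G g j k 0 = g k.
Proof.
  destruct j; simpl; [reflexivity|].
  rewrite (RInt_point 0 (fun s => G (fun l => picard G g j l s) k)).
  apply Rplus_0_r.
Qed.

(* The exponential weight makes the iteration contract by a factor [1/2] on all of
   [0, infinity). *)
Lemma picard_step_le : exists M mu, 0 < M /\ 0 < mu /\
  forall j k t, (k <= n)%nat -> 0 <= t ->
  Rabs (picard G g (S j) k t - picard G g j k t) <= M * (1/2) ^ j * exp (mu * t).
Proof.
  assert (Hn : 0 < INR (S n)) by (apply lt_0_INR; lia).
  (* Integrating the bound [L * INR (S n) * exp (mu * s)] divides it by [mu], which leaves exactly
     the factor [1/2]. In [M] below, [S0] bounds the first step and the added 1 makes [M]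
     positive. *)
  set (mu := 2 * L * INR (S n)).
  assert (Hmu : 0 < mu) by (unfold mu; nra).
  set (S0 := sum_f_R0 (fun k => Rabs (G g k)) n).
  assert (HS0 : 0 <= S0) by (apply sum_f_R0_nonneg; intros; apply Rabs_pos).
  set (M := (1 + S0) / mu).
  assert (HM : 0 < M) by (apply Rdiv_lt_0_compat; lra).
  exists M, mu. split; [exact HM|]. split; [exact Hmu|].
  assert (Hh : forall c s, is_derive (fun s => c * exp (mu * s)) s (c * (mu * exp (mu * s)))).
  { intros c s. apply (is_derive_scal (fun s => exp (mu * s))). apply is_derive_exp_scal. }
  assert (Hhc : forall c s, continuous (fun s => c * exp (mu * s)) s).
  { intros c s. apply (ex_derive_continuous (fun s => c * exp (mu * s))). eexists. apply Hh. }
  assert (Hhalf : forall j, 0 < (1/2) ^ j) by (intros; apply pow_lt; lra).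
  induction j as [|j IH]; intros k t Hk Ht.
  - apply (abs_le_of_derive_le (fun t => picard G g 1 k t - picard G g 0 k t)
      (fun _ => G g k) (fun t => M * (1/2)^0 * exp (mu * t))
      (fun s => M * (1/2)^0 * (mu * exp (mu * s))) (t + 1)); auto; [| | | |lra].
    + intros s. apply (continuous_minus (picard G g 1 k) (picard G g 0 k));
        apply continuous_picard; auto.
    + intros s Hs. rewrite <- (Rminus_0_r (G g k)).
      apply (is_derive_minus (picard G g 1 k) (picard G g 0 k)).
      * apply (is_derive_picard 0 k s Hk).
      * apply @is_derive_const.
    + intros s Hs. simpl (_ ^ 0).
      assert (E : 1 <= exp (mu * s)).
      { rewrite <- exp_0. left. apply exp_increasing. nra. }
      apply Rle_trans with (1 + S0).
      * assert (Rabs (G g k) <= S0); [|lra].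
        apply (term_le_sum_f_R0 (fun k => Rabs (G g k))); [intros; apply Rabs_pos|exact Hk].
      * replace (M * 1 * (mu * exp (mu * s))) with ((1 + S0) * exp (mu * s))
          by (unfold M; field; lra). nra.
    + rewrite !picard_initial, Rminus_diag, Rabs_R0, Rmult_0_r, exp_0. simpl. lra.
  - apply (abs_le_of_derive_le (fun t => picard G g (S (S j)) k t - picard G g (S j) k t)
      (fun t => G (fun l => picard G g (S j) l t) k - G (fun l => picard G g j l t) k)
      (fun t => M * (1/2)^(S j) * exp (mu * t))
      (fun s => M * (1/2)^(S j) * (mu * exp (mu * s))) (t + 1)); auto; [| | | |lra].
    + intros s. apply (continuous_minus (picard G g (S (S j)) k) (picard G g (S j) k));
        apply continuous_picard; auto.
    + intros s Hs.
      apply (is_derive_minus (picard G g (S (S j)) k) (picard G g (S j) k));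
        apply is_derive_picard, Hk.
    + intros s Hs. apply Rle_trans with (1 := HG _ _ _ Hk).
      apply Rle_trans with (L * (INR (S n) * (M * (1/2)^j * exp (mu * s)))).
      * apply Rmult_le_compat_l; [lra|]. apply sum_f_R0_le_const. intros l Hl.
        apply IH; [exact Hl|lra].
      * right. unfold mu at 2. simpl (_ ^ S j). field.
    + rewrite !picard_initial, Rminus_diag, Rabs_R0, Rmult_0_r, exp_0.
      specialize (Hhalf (S j)). nra.
Qed.

Lemma cauchy_lipschitz : exists u : nat -> R -> R,
  (forall k t, (k <= n)%nat -> continuous (u k) t) /\
  (forall k, (k <= n)%nat -> u k 0 = g k) /\
  (forall k t, (k <= n)%nat -> 0 < t -> is_derive (u k) t (G (fun j => u j t) k)).
Proof.
  destruct picard_step_le as [M [mu [HM [Hmu Hstep]]]].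
  assert (Hhalf : forall j, 0 < (1/2) ^ j) by (intros; apply pow_lt; lra).
  set (b := fun t j => 2 * M * exp (mu * t) * (1/2) ^ j).
  assert (Hb : forall t, is_lim_seq (b t) 0).
  { intros t. replace (Finite 0) with (Rbar_mult (2 * M * exp (mu * t)) 0)
      by (simpl; f_equal; ring).
    apply is_lim_seq_scal_l. apply is_lim_seq_geom. rewrite Rabs_right; lra. }
  assert (Hcauchy : forall k t, (k <= n)%nat -> 0 <= t -> forall N m, (0 <= N <= m)%nat ->
    Rabs (picard G g m k t - picard G g N k t) <= b t N).
  { intros k t Hk Ht N m HN.
    assert (E := exp_pos (mu * t)).
    (* Telescoping: the partial geometric sum is kept explicit so that the induction closes. *)
    assert (X : forall i, Rabs (picard G g (N + i) k t - picard G g N k t)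
      <= b t N * (1 - (1/2) ^ i)).
    { induction i as [|i IH].
      - rewrite Nat.add_0_r, Rminus_diag, Rabs_R0. simpl. lra.
      - rewrite Nat.add_succ_r. assert (Y := Hstep (N + i)%nat k t Hk Ht).
        rewrite pow_add in Y.
        assert (Z : M * ((1/2)^N * (1/2)^i) * exp (mu * t) = b t N * ((1/2)^i / 2))
          by (unfold b; field).
        rewrite Z in Y. apply Rabs_le_between in Y. apply Rabs_le_between in IH.
        simpl (_ ^ S i). apply Rabs_le. lra. }
    specialize (X (m - N)%nat). replace (N + (m - N))%nat with m in X by lia.
    apply Rle_trans with (1 := X).
    assert (0 < b t N).
    { unfold b. specialize (Hhalf N). apply Rmult_lt_0_compat; [nra|exact Hhalf]. }
    specialize (Hhalf (m - N)%nat). nra. }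
  set (U := fun k t => real (Lim_seq (fun j => picard G g j k t))).
  assert (HU : forall k t, (k <= n)%nat -> 0 <= t ->
    is_lim_seq (fun j => picard G g j k t) (U k t) /\
    forall N, (0 <= N)%nat -> Rabs (picard G g N k t - U k t) <= b t N).
  { intros k t Hk Ht. apply is_lim_seq_cauchy_rate; auto. }
  assert (Hunif : forall T eps, 0 < eps -> exists N, forall m, (N <= m)%nat ->
     forall k t, (k <= n)%nat -> 0 <= t <= T -> Rabs (picard G g m k t - U k t) <= eps).
  { intros T eps He. assert (X := Hb T). apply is_lim_seq_spec in X.
    destruct (X (mkposreal eps He)) as [N HN]. exists N. intros m Hm k t Hk Ht.
    specialize (HN m Hm). simpl in HN. rewrite Rminus_0_r in HN. apply Rabs_lt_between in HN.
    apply Rle_trans with (b t m); [apply HU; [exact Hk|lra|lia]|].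
    apply Rle_trans with (b T m); [|lra].
    unfold b. specialize (Hhalf m). apply Rmult_le_compat_r; [lra|].
    apply Rmult_le_compat_l; [lra|].
    assert (Y : mu * t <= mu * T) by nra.
    destruct Y as [Y|Y]; [left; apply exp_increasing, Y|rewrite Y; lra]. }
  (* The iterates are controlled only at nonnegative times. *)
  set (u := fun k t => U k (Rmax 0 t)).
  assert (Hu : forall k t, (k <= n)%nat -> continuous (u k) t).
  { intros k t Hk. apply (continuous_uniform_limit (fun j => picard G g j k) (U k)).
    - intros m s. apply continuous_picard, Hk.
    - intros T eps He. destruct (Hunif T eps He) as [N HN]. exists N.
      intros s Hs. apply HN; auto. }
  exists u. split; [exact Hu|]. split.
  - intros k Hk. unfold u, U. rewrite Rmax_left by lra.
    rewrite (Lim_seq_ext _ (fun _ => g k)) by (intros; apply picard_initial).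
    rewrite Lim_seq_const. reflexivity.
  - intros k t Hk Ht.
    apply (is_derive_Rmax0 (U k) t _ Ht).
    apply (is_derive_limit (fun m => picard G g (S m) k)
      (fun m t => G (fun l => picard G g m l t) k) (U k) (fun t => G (fun j => u j t) k)); auto.
    + intros m s. apply continuous_picard, Hk.
    + intros s. apply continuous_lipschitz_comp; auto.
    + intros T eps He.
      assert (Hn : 0 < INR (S n)) by (apply lt_0_INR; lia).
      destruct (Hunif T (eps / (L * INR (S n)))) as [N HN].
      { apply Rdiv_lt_0_compat; [exact He|]. nra. }
      exists N. intros m Hm s Hs. split; [apply is_derive_picard, Hk|].
      apply Rle_trans with (1 := HG _ _ _ Hk).
      apply Rle_trans with (L * (INR (S n) * (eps / (L * INR (S n))))).
      * apply Rmult_le_compat_l; [lra|]. apply sum_f_R0_le_const. intros j Hj.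
        unfold u. rewrite Rmax_right by lra. apply HN; auto. lra.
      * right. field. split; lra.
    + intros s Hs. apply is_lim_seq_incr_1 with (u := fun j => picard G g j k s).
      apply HU; auto.
Qed.

End Picard.

(** * Truncated systems *)

Lemma sum_f_R0_zero_tail (f : nat -> R) (n m : nat) :
  (n <= m)%nat -> (forall k, (n < k)%nat -> f k = 0) -> sum_f_R0 f m = sum_f_R0 f n.
Proof.
  intros H Hf. induction H as [|m Hm IH]; [reflexivity|].
  simpl. rewrite IH, (Hf (S m)) by lia. ring.
Qed.

Lemma drift_scal (A B : nat -> R) (th c : R) (x : nat -> R) (k : nat) :
  drift A B th (fun j => c * x j) k = c * drift A B th x k.
Proof. unfold drift. destruct k; simpl; ring. Qed.

(** The increments of the test sequence [k + 2] are 1, except the first one, which is 2 because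
    [prev] starts from 0. This is the extra dimer term of [release]. *)
Lemma release_eq (B x : nat -> R) (n : nat) :
  sum_f_R0 (fun k => B k * x k * (INR k + 2 - prev (fun j => INR j + 2) k)) n = release B x n.
Proof.
  unfold release. induction n.
  - simpl. ring.
  - rewrite !tech5, IHn, S_INR. simpl prev. ring.
Qed.

Section Truncation.

Context {A B r : nat -> R} {beta : R} (HAB : rates A B r beta).

(** [p] and [q] stand for the forward and backward increments of a test sequence that equals [k + 2]
    for [k <= m]. Below [m] the two sides agree term by term. From [m] on they differ by at most
    [2 * (th + beta) * A k * x k], which [rates_A_sublinear] and the mass turn into a multiple of
    [r m]. It is applied to the plain weight [k + 2] and to [tent]. *)
Lemma defect_approx (th : R) (x p q : nat -> R) (m n : nat) :
  (m <= n)%nat -> 0 <= th -> (forall k, 0 <= x k) -> mass x n <= 1 ->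
  (forall k, (k < m)%nat -> p k = 1) ->
  (forall k, (m <= k)%nat -> Rabs (p k - (if le_dec k m then 1 else 0)) <= 2) ->
  (forall k, (k < m)%nat -> q k = if le_dec k 0 then 2 else 1) ->
  (forall k, (m <= k)%nat ->
     Rabs (q k - ((if le_dec k m then 1 else 0) + (if le_dec k 0 then 1 else 0))) <= 2) ->
  Rabs (sum_f_R0 (fun k => A k * th * x k * p k) n - sum_f_R0 (fun k => B k * x k * q k) n
        - (th * uptake A x m - release B x m))
  <= 2 * (th + beta) / A 0%nat * r m.
Proof.
  intros Hmn Hth Hx Hm Hp1 Hp2 Hq1 Hq2.
  assert (hb := rates_beta_ge0 HAB). assert (Ap := rates_A_pos _ _ _ _ HAB).
  assert (A0 := Ap 0%nat). assert (rm := rates_r_pos HAB m).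
  unfold uptake, release.
  rewrite <- (sum_f_R0_indicator (fun k => A k * x k) m n Hmn).
  rewrite <- (sum_f_R0_indicator (fun k => B k * x k) m n Hmn).
  replace (B 0%nat * x 0%nat) with (sum_f_R0 (fun k => if le_dec k 0 then B k * x k else 0) n)
    by (rewrite (sum_f_R0_indicator (fun k => B k * x k) 0 n) by lia; reflexivity).
  rewrite <- sum_f_R0_scal, <- sum_plus, <- !minus_sum.
  apply Rle_trans with (sum_f_R0 (fun k => 2 * (th + beta) / A 0%nat * r m * ((INR k + 2) * x k)) n).
  - apply sum_f_R0_abs_le. intros k Hk.
    set (P := if le_dec k m then 1 else 0) in *.
    replace (A k * th * x k * p k - B k * x k * q k -
      (th * (if le_dec k m then A k * x k else 0) -
       ((if le_dec k m then B k * x k else 0) + (if le_dec k 0 then B k * x k else 0))))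
    with (A k * th * x k * (p k - (if le_dec k m then 1 else 0))
      - B k * x k * (q k - ((if le_dec k m then 1 else 0) + (if le_dec k 0 then 1 else 0))))
      by (destruct (le_dec k m), (le_dec k 0); ring).
    assert (Hk2 : 0 <= (INR k + 2) * x k).
    { assert (i := pos_INR k). specialize (Hx k). nra. }
    destruct (lt_dec k m) as [Hlt|Hge].
    + rewrite Hp1, Hq1 by exact Hlt. destruct (le_dec k m); [|lia].
      replace (A k * th * x k * (1 - 1) - B k * x k *
        ((if le_dec k 0 then 2 else 1) - (1 + (if le_dec k 0 then 1 else 0)))) with 0
        by (destruct (le_dec k 0); ring).
      rewrite Rabs_R0. apply Rmult_le_pos; [|exact Hk2]. apply Rmult_le_pos; [|lra].
      apply Rdiv_le_0_compat; lra.
    + assert (Hge' : (m <= k)%nat) by lia.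
      assert (X := Hp2 k Hge'). assert (Y := Hq2 k Hge').
      assert (a := Ap k). assert (b := rates_B_ge0 _ _ _ _ HAB k).
      assert (c := rates_B_le _ _ _ _ HAB k). assert (Hxk := Hx k).
      assert (s := rates_A_sublinear HAB m k Hge').
      apply Rle_trans with (A k * th * x k * 2 + beta * A k * x k * 2).
      * eapply Rle_trans; [apply Rabs_triang|]. rewrite Rabs_Ropp.
        rewrite (Rabs_mult (A k * th * x k)), (Rabs_mult (B k * x k)).
        rewrite (Rabs_right (A k * th * x k)), (Rabs_right (B k * x k))
          by (apply Rle_ge; repeat apply Rmult_le_pos; lra).
        apply Rplus_le_compat.
        -- apply Rmult_le_compat_l; [repeat apply Rmult_le_pos; lra|exact X].
        -- apply Rmult_le_compat; [apply Rmult_le_pos; lra|apply Rabs_pos| |exact Y].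
           apply Rmult_le_compat_r; lra.
      * replace (A k * th * x k * 2 + beta * A k * x k * 2) with (2 * (th + beta) * x k * A k) by ring.
        replace (2 * (th + beta) / A 0%nat * r m * ((INR k + 2) * x k))
          with (2 * (th + beta) * x k * (r m / A 0%nat * (INR k + 2))) by (field; lra).
        apply Rmult_le_compat_l; [|exact s]. apply Rmult_le_pos; lra.
  - rewrite sum_f_R0_scal. fold (mass x n).
    rewrite <- (Rmult_1_r (2 * (th + beta) / A 0%nat * r m)) at 2.
    apply Rmult_le_compat_l; [|exact Hm]. apply Rmult_le_pos; [|lra].
    apply Rdiv_le_0_compat; lra.
Qed.

Lemma release_bounds (x : nat -> R) (n : nat) :
  (forall k, 0 <= x k) -> 0 <= release B x n <= 2 * beta * uptake A x n.
Proof.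
  intros Hx. assert (Bp := rates_B_ge0 _ _ _ _ HAB). split.
  - apply Rplus_le_le_0_compat; [apply sum_f_R0_nonneg; intros|]; apply Rmult_le_pos; auto.
  - assert (E := release_sub_le HAB x (fun _ => 0) n).
    replace (release B (fun _ => 0) n) with 0 in E.
    + rewrite Rminus_0_r in E. apply Rle_trans with (1 := Rle_abs _).
      apply Rle_trans with (1 := E). right. f_equal. apply sum_eq. intros k _.
      rewrite Rminus_0_r, Rabs_right by (apply Rle_ge, Hx). reflexivity.
    + unfold release. transitivity (0 * sum_f_R0 (fun _ => 0) n + 0); [ring|].
      rewrite <- sum_f_R0_scal. f_equal; [apply sum_eq; intros|]; ring.
Qed.

Context (gamma : nat -> R) (n k0 : nat) (Hgamma : forall k, 0 <= gamma k)
  (Hk0 : 0 < gamma k0) (Hk0n : (k0 <= n)%nat).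

(** The floor [gamma] keeps the uptake positive, so that the quotient [quasi_steady] is harmless for
    every argument and the field is globally Lipschitz. Along the solution the floor is never
    active. The value 0 beyond [n] performs the truncation. *)
Definition clip (u : nat -> R) (k : nat) : R :=
  if le_dec k n then Rmax (u k) (gamma k) else 0.

Definition quasi_steady (v : nat -> R) : R := release B v n / uptake A v n.

(** Bounds the loss rate [A k * th + B k] for all [k <= n]: [2 * beta * A n] for growth and
    [beta * A n] for break-up. *)
Definition diag_shift : R := 3 * beta * A n.

(* Multiplying the truncated system by [exp (diag_shift * t)] adds [diag_shift] to the diagonal,
   which makes the vector field nonnegative; [quasi_steady] is homogeneous of degree
   zero and so is unaffected. *)
Definition vector_field (u : nat -> R) (k : nat) : R :=
  diag_shift * clip u k + drift A B (quasi_steady (clip u)) (clip u) k.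

Lemma clip_ge0 (u : nat -> R) (k : nat) : 0 <= clip u k.
Proof.
  unfold clip. destruct (le_dec k n); [|lra].
  apply Rle_trans with (2 := Rmax_r _ _). apply Hgamma.
Qed.

Lemma clip_sub_le (u u' : nat -> R) (k : nat) :
  Rabs (clip u k - clip u' k) <= Rabs (u k - u' k).
Proof.
  unfold clip. destruct (le_dec k n).
  - unfold Rmax. destruct (Rle_dec (u k) (gamma k)), (Rle_dec (u' k) (gamma k));
      unfold Rabs; repeat destruct Rcase_abs; lra.
  - rewrite Rminus_diag, Rabs_R0. apply Rabs_pos.
Qed.

Lemma uptake_clip_pos (u : nat -> R) : 0 < uptake A (clip u) n.
Proof.
  assert (Ap := rates_A_pos _ _ _ _ HAB).
  apply Rlt_le_trans with (A k0 * clip u k0).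
  - apply Rmult_lt_0_compat; [apply Ap|]. unfold clip. destruct (le_dec k0 n); [|lia].
    apply Rlt_le_trans with (1 := Hk0). apply Rmax_r.
  - apply (term_le_sum_f_R0 (fun k => A k * clip u k)); [|exact Hk0n].
    intros j _. apply Rmult_le_pos; [left; apply Ap|apply clip_ge0].
Qed.

Lemma quasi_steady_eq (u : nat -> R) :
  quasi_steady (clip u) * uptake A (clip u) n = release B (clip u) n.
Proof.
  unfold quasi_steady. assert (p := uptake_clip_pos u). field. lra.
Qed.

Lemma quasi_steady_bound (u : nat -> R) : 0 <= quasi_steady (clip u) <= 2 * beta.
Proof.
  assert (p := uptake_clip_pos u). assert (q := release_bounds (clip u) n (clip_ge0 u)).
  split.
  - apply Rdiv_le_0_compat; lra.
  - apply Rmult_le_reg_r with (1 := p). rewrite quasi_steady_eq. lra.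
Qed.

Lemma clip_gt (u : nat -> R) (k : nat) : (n < k)%nat -> clip u k = 0.
Proof. intros H. unfold clip. destruct (le_dec k n); [lia|reflexivity]. Qed.

Lemma vector_field_ge0 (u : nat -> R) (k : nat) : (k <= n)%nat -> 0 <= vector_field u k.
Proof.
  intros Hk. unfold vector_field, drift, diag_shift.
  assert (hb := rates_beta_ge0 HAB). assert (Ap := rates_A_pos _ _ _ _ HAB).
  assert (b := rates_B_ge0 _ _ _ _ HAB (S k)).
  assert (c := rates_B_le _ _ _ _ HAB k). assert (d := rates_A_le HAB k n Hk).
  assert (t := quasi_steady_bound u). assert (v := clip_ge0 u).
  assert (Y1 : 0 <= prev (fun j => A j * quasi_steady (clip u) * clip u j) k).
  { destruct k as [|j]; simpl; [lra|]. specialize (Ap j).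
    apply Rmult_le_pos; [apply Rmult_le_pos; lra|apply v]. }
  assert (Y2 : 0 <= B (S k) * clip u (S k)) by (apply Rmult_le_pos; auto).
  assert (Y3 : (A k * quasi_steady (clip u) + B k) * clip u k <= 3 * beta * A n * clip u k).
  { apply Rmult_le_compat_r; [apply v|]. specialize (Ap k). nra. }
  lra.
Qed.

(** The quotient does no harm: its variation times [uptake A v' n] is at most [4 * beta * Sm], and
    it is only ever multiplied by some [A j * v' j], a single term of that uptake. The constant 14
    adds 6 for each of the two growth terms and 1 for each of the two break-up terms; the final 1
    makes the Lipschitz constant positive. *)
Lemma vector_field_lipschitz (u u' : nat -> R) (k : nat) : (k <= n)%nat ->
  Rabs (vector_field u k - vector_field u' k) <=
  ((diag_shift / A 0%nat + 14 * beta) * A n + 1) * sum_f_R0 (fun j => Rabs (u j - u' j)) n.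
Proof.
  intros Hk.
  assert (hb := rates_beta_ge0 HAB). assert (Ap := rates_A_pos _ _ _ _ HAB).
  assert (A0 := Ap 0%nat).
  set (v := clip u). set (v' := clip u').
  set (Sm := sum_f_R0 (fun j => A j * Rabs (v j - v' j)) n).
  assert (Hterm : forall j, A j * Rabs (v j - v' j) <= Sm).
  { intros j. destruct (le_dec j n) as [Hj|Hj].
    - apply (term_le_sum_f_R0 (fun j => A j * Rabs (v j - v' j))); [|exact Hj].
      intros i _. apply Rmult_le_pos; [left; apply Ap|apply Rabs_pos].
    - unfold v, v'. rewrite !clip_gt, Rminus_diag, Rabs_R0, Rmult_0_r by lia.
      apply sum_f_R0_nonneg. intros i _. apply Rmult_le_pos; [left; apply Ap|apply Rabs_pos]. }
  assert (HS0 : 0 <= Sm).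
  { apply Rle_trans with (2 := Hterm 0%nat). apply Rmult_le_pos; [lra|apply Rabs_pos]. }
  assert (HSm : Sm <= A n * sum_f_R0 (fun j => Rabs (u j - u' j)) n).
  { unfold Sm. rewrite <- sum_f_R0_scal. apply sum_Rle. intros j Hj.
    apply Rmult_le_compat; [left; apply Ap|apply Rabs_pos|apply (rates_A_le HAB), Hj|apply clip_sub_le]. }
  assert (Hth : Rabs (quasi_steady v - quasi_steady v') * uptake A v' n <= 4 * beta * Sm).
  { replace (4 * beta * Sm) with (4 * beta * Sm + 2 * 0) by ring.
    apply (monomer_sub_uptake_le HAB _ _ 0 v v' n (quasi_steady_bound u) (clip_ge0 u'));
      unfold v, v'; rewrite quasi_steady_eq, Rminus_diag, Rabs_R0; lra. }
  assert (Hgain : forall j, (j <= n)%nat ->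
     Rabs (A j * quasi_steady v * v j - A j * quasi_steady v' * v' j) <= 6 * beta * Sm).
  { intros j Hj.
    replace (A j * quasi_steady v * v j - A j * quasi_steady v' * v' j)
      with (quasi_steady v * (A j * (v j - v' j))
            + (quasi_steady v - quasi_steady v') * (A j * v' j)) by ring.
    eapply Rle_trans; [apply Rabs_triang|].
    replace (6 * beta * Sm) with (2 * beta * Sm + 4 * beta * Sm) by ring.
    apply Rplus_le_compat.
    - rewrite !Rabs_mult, (Rabs_right (A j)) by (left; apply Ap).
      assert (q := quasi_steady_bound u). rewrite Rabs_right by (unfold v; lra).
      apply Rmult_le_compat; [unfold v; lra| |unfold v; lra|apply Hterm].
      apply Rmult_le_pos; [left; apply Ap|apply Rabs_pos].
    - assert (p : 0 <= A j * v' j) by (apply Rmult_le_pos; [left; apply Ap|apply clip_ge0]).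
      rewrite Rabs_mult, (Rabs_right (A j * v' j)) by lra.
      apply Rle_trans with (2 := Hth). apply Rmult_le_compat_l; [apply Rabs_pos|].
      apply (term_le_sum_f_R0 (fun j => A j * v' j)); [|exact Hj].
      intros i _. apply Rmult_le_pos; [left; apply Ap|apply clip_ge0]. }
  assert (Hloss : forall j, Rabs (B j * v j - B j * v' j) <= beta * Sm).
  { intros j. replace (B j * v j - B j * v' j) with (B j * (v j - v' j)) by ring.
    rewrite Rabs_mult, (Rabs_right (B j)) by (apply Rle_ge, (rates_B_ge0 _ _ _ _ HAB)).
    apply Rle_trans with (beta * (A j * Rabs (v j - v' j))).
    - rewrite <- Rmult_assoc. apply Rmult_le_compat_r; [apply Rabs_pos|].
      apply (rates_B_le _ _ _ _ HAB).
    - apply Rmult_le_compat_l; [exact hb|apply Hterm]. }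
  assert (Hdiag : Rabs (diag_shift * v k - diag_shift * v' k) <= diag_shift / A 0%nat * Sm).
  { replace (diag_shift * v k - diag_shift * v' k) with (diag_shift * (v k - v' k)) by ring.
    assert (Hsh : 0 <= diag_shift) by (unfold diag_shift; specialize (Ap n); nra).
    rewrite Rabs_mult, (Rabs_right diag_shift) by lra.
    unfold Rdiv. rewrite Rmult_assoc. apply Rmult_le_compat_l; [exact Hsh|].
    apply Rmult_le_reg_l with (1 := A0). rewrite <- Rmult_assoc, Rinv_r, Rmult_1_l by lra.
    apply Rle_trans with (2 := Hterm k). apply Rmult_le_compat_r; [apply Rabs_pos|].
    apply (rates_A_le HAB). lia. }
  apply Rle_trans with ((diag_shift / A 0%nat + 14 * beta) * Sm).
  - unfold vector_field. fold v v'. unfold drift.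
    assert (Hprev : Rabs (prev (fun j => A j * quasi_steady v * v j) k
                   - prev (fun j => A j * quasi_steady v' * v' j) k) <= 6 * beta * Sm).
    { destruct k as [|j]; simpl.
      - rewrite Rminus_diag, Rabs_R0. nra.
      - apply Hgain. lia. }
    assert (H1 := Hgain k Hk). assert (H2 := Hloss k). assert (H3 := Hloss (S k)).
    apply Rabs_le_between in Hprev. apply Rabs_le_between in H1. apply Rabs_le_between in H2.
    apply Rabs_le_between in H3. apply Rabs_le_between in Hdiag.
    apply Rabs_le. lra.
  - assert (Hs : 0 <= sum_f_R0 (fun j => Rabs (u j - u' j)) n)
      by (apply sum_f_R0_nonneg; intros; apply Rabs_pos).
    assert (0 <= diag_shift / A 0%nat + 14 * beta).
    { apply Rplus_le_le_0_compat; [|lra]. apply Rdiv_le_0_compat; [|exact A0].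
      unfold diag_shift; specialize (Ap n); nra. }
    nra.
Qed.

Lemma approx_truncated (Hmass : mass gamma n <= 1) :
  exists th x, approx A B r beta gamma n th x.
Proof.
  assert (hb := rates_beta_ge0 HAB). assert (Ap := rates_A_pos _ _ _ _ HAB).
  assert (A0 := Ap 0%nat). assert (An := Ap n).
  assert (HL : 0 < (diag_shift / A 0%nat + 14 * beta) * A n + 1).
  { assert (0 <= diag_shift / A 0%nat).
    { apply Rdiv_le_0_compat; [|exact A0]. unfold diag_shift; nra. }
    nra. }
  destruct (cauchy_lipschitz n vector_field _ HL vector_field_lipschitz gamma) as [u [Hc [H0 Hd]]].
  (* The shifted field is nonnegative, so each component stays above its initial value and the
     clipping is inactive. Undoing the exponential factor then yields a solution of the truncated
     system itself. *)
  assert (Hmono : forall k t, (k <= n)%nat -> 0 <= t -> gamma k <= u k t).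
  { intros k t Hk Ht.
    assert (E : (fun s => - u k s) t <= (fun s => - u k s) 0).
    { apply (le_initial_of_derive_nonpos (fun s => - u k s)
        (fun s => - vector_field (fun j => u j s) k) (t + 1)); [| | |lra].
      - intros s. apply (continuous_opp (u k)). auto.
      - intros s Hs. apply (is_derive_opp (u k)). apply Hd; [exact Hk|lra].
      - intros s Hs. assert (p := vector_field_ge0 (fun j => u j s) k Hk). lra. }
    simpl in E. rewrite H0 in E by exact Hk. lra. }
  set (v := fun t => clip (fun j => u j t)).
  assert (Hv : forall k t, (k <= n)%nat -> 0 <= t -> v t k = u k t).
  { intros k t Hk Ht. unfold v, clip. destruct (le_dec k n); [|lia].
    apply Rmax_left, Hmono; auto. }
  assert (Hvc : forall k t, continuous (fun s => v s k) t).
  { intros k t. destruct (le_dec k n) as [Hk|Hk].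
    - apply (continuous_lipschitz_comp n clip 1 Rlt_0_1); [|exact Hk|auto].
      intros w w' j Hj. rewrite Rmult_1_l. apply Rle_trans with (1 := clip_sub_le w w' j).
      apply (term_le_sum_f_R0 (fun j => Rabs (w j - w' j))); [intros; apply Rabs_pos|exact Hj].
    - apply continuous_ext with (fun _ => 0); [|apply continuous_const].
      intros s. symmetry. apply clip_gt. lia. }
  set (x := fun k t => exp (- diag_shift * t) * v t k).
  set (th := fun t => quasi_steady (v t)).
  assert (Hx0 : forall k t, 0 <= x k t).
  { intros k t. apply Rmult_le_pos; [left; apply exp_pos|apply clip_ge0]. }
  assert (Hgt : forall k t, (n < k)%nat -> x k t = 0).
  { intros k t Hk. unfold x, v. rewrite clip_gt by exact Hk. ring. }
  assert (Hup : forall t, uptake A (fun k => x k t) n = exp (- diag_shift * t) * uptake A (v t) n).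
  { intros t. unfold uptake. rewrite <- sum_f_R0_scal. apply sum_eq. intros; unfold x; ring. }
  assert (Hrel : forall t, release B (fun k => x k t) n = exp (- diag_shift * t) * release B (v t) n).
  { intros t. unfold release. rewrite Rmult_plus_distr_l, <- sum_f_R0_scal.
    f_equal; [apply sum_eq; intros|]; unfold x; ring. }
  assert (Hdef : forall t, th t * uptake A (fun k => x k t) n = release B (fun k => x k t) n).
  { intros t. rewrite Hup, Hrel. unfold th.
    assert (q : quasi_steady (v t) * uptake A (v t) n = release B (v t) n)
      by apply quasi_steady_eq.
    rewrite <- q. ring. }
  assert (Hth : forall t, 0 <= th t <= 2 * beta) by (intros; apply quasi_steady_bound).
  assert (Hxc : forall k t, continuous (x k) t).
  { intros k t. apply (continuous_mult (fun t => exp (- diag_shift * t)) (fun t => v t k)); auto.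
    apply continuous_exp_scal. }
  assert (Hode : forall k t, (k <= n)%nat -> 0 < t ->
    is_derive (x k) t (drift A B (th t) (fun j => x j t) k)).
  { intros k t Hk Ht.
    apply is_derive_ext_loc with (fun s => exp (- diag_shift * s) * u k s).
    - exists (mkposreal t Ht). intros s Hs. change (Rabs (s - t) < t) in Hs.
      apply Rabs_lt_between in Hs. unfold x. rewrite Hv; [reflexivity|exact Hk|lra].
    - replace (drift A B (th t) (fun j => x j t) k) with
        (- diag_shift * exp (- diag_shift * t) * u k t + exp (- diag_shift * t) * vector_field (fun j => u j t) k).
      + apply (is_derive_mult (fun s => exp (- diag_shift * s)) (u k)).
        apply is_derive_exp_scal. auto. intros; apply Rmult_comm.
      + unfold x. rewrite drift_scal. 
        change (vector_field (fun j => u j t) k)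
          with (diag_shift * v t k + drift A B (th t) (v t) k).
        change (drift A B (th t) (fun j => v t j) k) with (drift A B (th t) (v t) k).
        rewrite Hv by (auto; lra). ring. }
  (* By the choice of [quasi_steady], uptake and release cancel exactly. What remains of the
     derivative of the mass is the loss of clusters growing past [n], which is nonpositive. *)
  assert (Hmassn : forall t, 0 <= t -> mass (fun k => x k t) n <= 1).
  { intros t Ht.
    assert (E : (fun s => mass (fun k => x k s) n) t <= (fun s => mass (fun k => x k s) n) 0).
    { apply (le_initial_of_derive_nonpos (fun s => mass (fun k => x k s) n)
        (fun s => sum_f_R0 (fun k => (INR k + 2) * drift A B (th s) (fun j => x j s) k) n)
        (t + 1)); [| | |lra].
      - intros s. apply (continuous_sum_f_R0 (fun k s => (INR k + 2) * x k s)).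
        intros k _. apply (continuous_mult (fun _ => INR k + 2) (x k)); auto. apply continuous_const.
      - intros s Hs. apply (is_derive_sum_f_R0 (fun k s => (INR k + 2) * x k s)
          (fun k s => (INR k + 2) * drift A B (th s) (fun j => x j s) k)).
        intros k Hk. apply (is_derive_scal (x k)). apply Hode; [exact Hk|lra].
      - intros s Hs.
        rewrite (sum_drift_by_parts A B (th s) (fun j => x j s) (fun k => INR k + 2)).
        rewrite release_eq, (Hgt (S n)), <- Hdef by lia. unfold uptake.
        replace (sum_f_R0 (fun k => A k * th s * x k s * (INR (S k) + 2 - (INR k + 2))) n)
          with (th s * sum_f_R0 (fun k => A k * x k s) n).
        2: { rewrite <- sum_f_R0_scal. apply sum_eq. intros k _. rewrite S_INR. ring. }
        assert (0 <= (INR (S n) + 2) * A n * th s * x n s).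
        { assert (i := pos_INR (S n)). assert (q := Hth s).
          apply Rmult_le_pos; [|apply Hx0]. apply Rmult_le_pos; [nra|apply q]. }
        lra. }
    apply Rle_trans with (1 := E). apply Rle_trans with (2 := Hmass). right.
    unfold mass. apply sum_eq. intros k Hk. unfold x.
    rewrite Rmult_0_r, exp_0, Hv, H0 by (auto; lra). ring. }
  assert (Hmass_all : forall m t, 0 <= t -> mass (fun k => x k t) m <= 1).
  { intros m t Ht. apply Rle_trans with (2 := Hmassn t Ht).
    apply Rle_trans with (mass (fun k => x k t) (Nat.max m n)).
    - apply sum_f_R0_le_wider; [|lia]. intros k. assert (i := pos_INR k).
      apply Rmult_le_pos; [lra|apply Hx0].
    - right. apply sum_f_R0_zero_tail; [lia|]. intros k Hk. rewrite Hgt by exact Hk. ring. }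
  exists th, x. split; auto.
  - intros t. unfold th, quasi_steady, Rdiv.
    apply (continuous_mult (fun t => release B (v t) n) (fun t => / uptake A (v t) n)).
    + apply (continuous_plus (fun t => sum_f_R0 (fun k => B k * v t k) n)
        (fun t => B 0%nat * v t 0%nat)).
      * apply (continuous_sum_f_R0 (fun k t => B k * v t k)). intros k _.
        apply (continuous_mult (fun _ => B k) (fun t => v t k)); auto. apply continuous_const.
      * apply (continuous_mult (fun _ => B 0%nat) (fun t => v t 0%nat)); auto. apply continuous_const.
    + apply (continuous_comp (fun t => uptake A (v t) n) Rinv).
      * apply (continuous_sum_f_R0 (fun k t => A k * v t k)). intros k _.
        apply (continuous_mult (fun _ => A k) (fun t => v t k)); auto. apply continuous_const.
      * apply continuous_Rinv. apply Rgt_not_eq, uptake_clip_pos.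
  - intros m t Ht.
    (* The defect is needed for every [m], also beyond [n]. As [x] vanishes there, the exact balance
       at [n] persists at [nn], and [m <= nn] as [defect_approx] requires. *)
    set (nn := Nat.max m n).
    assert (E1 : uptake A (fun k => x k t) nn = uptake A (fun k => x k t) n).
    { apply sum_f_R0_zero_tail; [unfold nn; lia|]. intros k Hk. rewrite Hgt by exact Hk. ring. }
    assert (E2 : release B (fun k => x k t) nn = release B (fun k => x k t) n).
    { unfold release. f_equal.
      apply sum_f_R0_zero_tail; [unfold nn; lia|]. intros k Hk. rewrite Hgt by exact Hk. ring. }
    assert (X := defect_approx (th t) (fun k => x k t) (fun _ => 1)
      (fun k => if le_dec k 0 then 2 else 1) m nn ltac:(unfold nn; lia) (proj1 (Hth t))
      (fun k => Hx0 k t) (Hmass_all nn t Ht)).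
    assert (Z : sum_f_R0 (fun k => A k * th t * x k t * 1) nn
       - sum_f_R0 (fun k => B k * x k t * (if le_dec k 0 then 2 else 1)) nn = 0).
    { replace (sum_f_R0 (fun k => A k * th t * x k t * 1) nn)
        with (th t * uptake A (fun k => x k t) nn)
        by (unfold uptake; rewrite <- sum_f_R0_scal; apply sum_eq; intros; ring).
      rewrite E1, Hdef, <- E2, <- release_eq. apply Rminus_diag_eq, sum_eq.
      intros k _. destruct k; simpl le_dec.
      - simpl. ring.
      - destruct (le_dec (S k) 0); [lia|]. rewrite S_INR. simpl prev. ring. }
    cbv beta in X. rewrite Z in X. rewrite Rminus_0_l, Rabs_Ropp in X.
    apply Rle_trans with (2 * (th t + beta) / A 0%nat * r m).
    + apply X; intros k Hk; try (destruct (le_dec k m); [|try lia]); destruct (le_dec k 0);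
        try reflexivity; apply Rabs_le; lra.
    + apply Rmult_le_compat_r; [left; apply (rates_r_pos HAB)|].
      apply Rmult_le_compat_r; [left; apply Rinv_0_lt_compat, A0|]. specialize (Hth t). lra.
  - intros k Hk. unfold x. rewrite Rmult_0_r, exp_0, Hv, H0 by (auto; lra). ring.
Qed.

End Truncation.

(** * Limit of the truncated systems *)

Lemma is_lim_seq_sum_f_R0 (u : nat -> nat -> R) (l : nat -> R) (m : nat) :
  (forall k, (k <= m)%nat -> is_lim_seq (fun i => u i k) (l k)) ->
  is_lim_seq (fun i => sum_f_R0 (u i) m) (sum_f_R0 l m).
Proof.
  induction m as [|m IH]; intros H; simpl.
  - apply H. lia.
  - apply (is_lim_seq_plus' (fun i => sum_f_R0 (u i) m) (fun i => u i (S m))).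
    + apply IH. intros; apply H; lia.
    + apply H. lia.
Qed.

Lemma is_lim_seq_bounds (u : nat -> R) (l a b : R) :
  is_lim_seq u l -> (forall i, a <= u i <= b) -> a <= l <= b.
Proof.
  intros Hu Hb. split.
  - apply (is_lim_seq_le (fun _ => a) u a l); auto; [apply Hb|apply is_lim_seq_const].
  - apply (is_lim_seq_le u (fun _ => b) l b); auto; [apply Hb|apply is_lim_seq_const].
Qed.

Lemma continuous_drift (A B : nat -> R) (th : R -> R) (x : nat -> R -> R) (k : nat) (t : R) :
  continuous th t -> (forall j, continuous (x j) t) ->
  continuous (fun s => drift A B (th s) (fun j => x j s) k) t.
Proof.
  intros Hth Hx.
  assert (Hgain : forall j, continuous (fun s => A j * th s * x j s) t).
  { intros j. apply (continuous_mult (fun s => A j * th s) (x j)); auto.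
    apply (continuous_mult (fun _ => A j) th); auto. apply continuous_const. }
  unfold drift.
  apply (continuous_plus (fun s => prev (fun j => A j * th s * x j s) k - (A k * th s + B k) * x k s)
    (fun s => B (S k) * x (S k) s)).
  - apply (continuous_minus (fun s => prev (fun j => A j * th s * x j s) k)
      (fun s => (A k * th s + B k) * x k s)).
    + destruct k as [|j]; simpl; [apply continuous_const|apply Hgain].
    + apply (continuous_mult (fun s => A k * th s + B k) (x k)); auto.
      apply (continuous_plus (fun s => A k * th s) (fun _ => B k)); [|apply continuous_const].
      apply (continuous_mult (fun _ => A k) th); auto. apply continuous_const.
  - apply (continuous_mult (fun _ => B (S k)) (x (S k))); auto. apply continuous_const.
Qed.

Section Limit.

Context {A B r : nat -> R} {beta : R} (HAB : rates A B r beta).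

(** Used to pass to the limit in one fixed equation, so the growth of the bound with [k] does not
    matter. The constant is [2 * beta + 1] for each of the two growth terms and [beta] for each of
    the two break-up terms. *)
Lemma drift_sub_le (th th' eta : R) (x x' : nat -> R) (k : nat) :
  0 <= th <= 2 * beta -> (forall j, 0 <= x' j <= 1) -> Rabs (th - th') <= eta ->
  (forall j, (j <= S k)%nat -> Rabs (x j - x' j) <= eta) ->
  Rabs (drift A B th x k - drift A B th' x' k) <= (6 * beta + 2) * A (S k) * eta.
Proof.
  intros Hth Hx' Hd Hx.
  assert (hb := rates_beta_ge0 HAB). assert (Ap := rates_A_pos _ _ _ _ HAB).
  assert (He : 0 <= eta) by (apply Rle_trans with (2 := Hd); apply Rabs_pos).
  assert (Hgain : forall j, (j <= S k)%nat ->
    Rabs (A j * th * x j - A j * th' * x' j) <= (2 * beta + 1) * A (S k) * eta).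
  { intros j Hj.
    replace (A j * th * x j - A j * th' * x' j)
      with (A j * (th * (x j - x' j) + (th - th') * x' j)) by ring.
    rewrite Rabs_mult, (Rabs_right (A j)) by (left; apply Ap).
    replace ((2 * beta + 1) * A (S k) * eta) with (A (S k) * (2 * beta * eta + eta * 1)) by ring.
    apply Rmult_le_compat; [left; apply Ap|apply Rabs_pos|apply (rates_A_le HAB), Hj|].
    eapply Rle_trans; [apply Rabs_triang|]. rewrite !Rabs_mult.
    rewrite (Rabs_right th), (Rabs_right (x' j)) by (try apply Rle_ge, Hx'; lra).
    specialize (Hx j Hj). assert (p := Rabs_pos (x j - x' j)). assert (p' := Rabs_pos (th - th')).
    destruct (Hx' j). apply Rplus_le_compat; apply Rmult_le_compat; lra. }
  assert (Hloss : forall j, (j <= S k)%nat ->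
    Rabs (B j * x j - B j * x' j) <= beta * A (S k) * eta).
  { intros j Hj. replace (B j * x j - B j * x' j) with (B j * (x j - x' j)) by ring.
    rewrite Rabs_mult, (Rabs_right (B j)) by (apply Rle_ge, (rates_B_ge0 _ _ _ _ HAB)).
    apply Rmult_le_compat; [apply (rates_B_ge0 _ _ _ _ HAB)|apply Rabs_pos| |auto].
    apply Rle_trans with (1 := rates_B_le _ _ _ _ HAB j).
    apply Rmult_le_compat_l; [exact hb|]. apply (rates_A_le HAB), Hj. }
  assert (Hprev : Rabs (prev (fun j => A j * th * x j) k - prev (fun j => A j * th' * x' j) k)
     <= (2 * beta + 1) * A (S k) * eta).
  { destruct k as [|j]; simpl.
    - rewrite Rminus_diag, Rabs_R0. specialize (Ap 1%nat).
      apply Rmult_le_pos; [|exact He]. apply Rmult_le_pos; lra.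
    - apply Hgain. lia. }
  assert (H1 := Hgain k ltac:(lia)). assert (H2 := Hloss k ltac:(lia)).
  assert (H3 := Hloss (S k) ltac:(lia)).
  apply Rabs_le_between in Hprev. apply Rabs_le_between in H1. apply Rabs_le_between in H2.
  apply Rabs_le_between in H3. unfold drift. apply Rabs_le. lra.
Qed.

Context (gamma : nat -> R).

(** Each clause of [approx] concerns finitely many components, hence survives the locally uniform
    limit of the truncated solutions. The same limit serves every [n], so it satisfies all the
    equations. *)
Lemma approx_limit (k0 : nat) :
  (forall k, 0 <= gamma k) -> 0 < gamma k0 -> (forall m, mass gamma m <= 1) ->
  exists th x, forall n, approx A B r beta gamma n th x.
Proof.
  intros Hg Hk0 Hm.
  assert (hb := rates_beta_ge0 HAB). assert (Ap := rates_A_pos _ _ _ _ HAB).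
  assert (A0 := Ap 0%nat). assert (hr := rates_r_pos HAB).
  (* Truncation starts at [k0], so that every system contains a populated size and the stability
     constant is common to all of them. *)
  destruct (functional_choice (fun i (p : (R -> R) * (nat -> R -> R)) =>
    approx A B r beta gamma (k0 + i) (fst p) (snd p))) as [seq Hseq].
  { intros i. destruct (approx_truncated HAB gamma (k0 + i) k0 Hg Hk0 ltac:(lia) (Hm _))
      as [th [x H]]. exists (th, x). exact H. }
  set (TH := fun i => fst (seq i)). set (X := fun i => snd (seq i)).
  assert (HX : forall i m, (i <= m)%nat -> approx A B r beta gamma (k0 + i) (TH m) (X m)).
  { intros i m H. apply approx_weaken with (k0 + m)%nat; [lia|]. apply Hseq. }
  assert (Hdist : forall T, 0 <= T -> exists b : nat -> R, is_lim_seq b 0 /\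
    forall N m t, (N <= m)%nat -> 0 <= t <= T ->
      Rabs (TH m t - TH N t) <= b N /\
      forall k, (k <= k0 + N)%nat -> Rabs (X m k t - X N k t) <= b N).
  { intros T HT. destruct (approx_stable HAB gamma k0 T Hk0 HT) as [C [HC Hst]].
    exists (fun i => (C + C / A 0%nat) * r (k0 + i)%nat). split.
    - replace (Finite 0) with (Rbar_mult (C + C / A 0%nat) 0) by (simpl; f_equal; ring).
      apply is_lim_seq_scal_l.
      apply is_lim_seq_ext with (fun i => r (i + k0)%nat); [intros; f_equal; lia|].
      apply is_lim_seq_incr_n with (u := r), (rates_r_lim _ _ _ _ HAB).
    - intros N m t HN Ht.
      (* The two solutions are compared at the smaller of their truncation indices, where both
         satisfy [approx]. *)
      destruct (Hst (k0 + N)%nat (TH m) (X m) (TH N) (X N) ltac:(lia)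
        (HX N m HN) (HX N N ltac:(lia)) t Ht) as [S1 S2].
      assert (rN := hr (k0 + N)%nat).
      assert (P : 0 < C / A 0%nat) by (apply Rdiv_lt_0_compat; lra).
      split; [nra|]. intros k Hk.
      apply Rle_trans with (C / A 0%nat * r (k0 + N)%nat); [|nra].
      apply Rmult_le_reg_l with (1 := A0).
      replace (A 0%nat * (C / A 0%nat * r (k0 + N)%nat)) with (C * r (k0 + N)%nat) by (field; lra).
      apply Rle_trans with (2 := S1).
      apply Rle_trans with (A k * Rabs (X m k t - X N k t)).
      + apply Rmult_le_compat_r; [apply Rabs_pos|]. apply (rates_A_le HAB). lia.
      + apply (term_le_sum_f_R0 (fun k => A k * Rabs (X m k t - X N k t))); [|exact Hk].
        intros j _. apply Rmult_le_pos; [left; apply Ap|apply Rabs_pos]. }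
  set (Lth := fun t => real (Lim_seq (fun i => TH i t))).
  set (Lx := fun k t => real (Lim_seq (fun i => X i k t))).
  assert (Hlim_th : forall t, 0 <= t -> is_lim_seq (fun i => TH i t) (Lth t)).
  { intros t Ht. destruct (Hdist t Ht) as [b [Hb Hbd]].
    apply (is_lim_seq_cauchy_rate _ b 0); [|exact Hb].
    intros N m HN. apply Hbd; [lia|lra]. }
  assert (Hlim_x : forall k t, 0 <= t -> is_lim_seq (fun i => X i k t) (Lx k t)).
  { intros k t Ht. destruct (Hdist t Ht) as [b [Hb Hbd]].
    apply (is_lim_seq_cauchy_rate _ b k); [|exact Hb].
    intros N m HN. apply Hbd; [lia|lra|lia]. }
  assert (Hunif : forall T eps, 0 <= T -> 0 < eps -> exists N, forall i t, (N <= i)%nat ->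
     0 <= t <= T -> Rabs (TH i t - Lth t) <= eps /\
     forall k, (k <= i)%nat -> Rabs (X i k t - Lx k t) <= eps).
  { intros T eps HT He. destruct (Hdist T HT) as [b [Hb Hbd]].
    assert (Hb' := Hb). apply is_lim_seq_spec in Hb'.
    destruct (Hb' (mkposreal eps He)) as [N HN]. exists N. intros i t Hi Ht.
    specialize (HN i Hi). simpl in HN. rewrite Rminus_0_r in HN. apply Rabs_lt_between in HN.
    split; [|intros k Hk]; apply Rle_trans with (b i); try lra.
    - apply (is_lim_seq_cauchy_rate (fun i => TH i t) b 0); [|exact Hb|lia].
      intros p m Hp. apply Hbd; [lia|lra].
    - apply (is_lim_seq_cauchy_rate (fun i => X i k t) b k); [|exact Hb|lia].
      intros p m Hp. apply Hbd; [lia|lra|lia]. }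
  set (th := fun t => Lth (Rmax 0 t)). set (x := fun k t => Lx k (Rmax 0 t)).
  assert (Hth_eq : forall t, 0 <= t -> th t = Lth t)
    by (intros t Ht; unfold th; rewrite Rmax_right by lra; reflexivity).
  assert (Hx_eq : forall k t, 0 <= t -> x k t = Lx k t)
    by (intros k t Ht; unfold x; rewrite Rmax_right by lra; reflexivity).
  assert (Hthc : forall t, continuous th t).
  { apply (continuous_uniform_limit TH Lth).
    - intros m. apply (approx_th_cont _ _ _ _ _ _ _ _ (HX m m (le_n m))).
    - intros T eps He. destruct (Hunif (Rmax 0 T) eps (Rmax_l 0 T) He) as [N HN]. exists N.
      intros t Ht. apply HN; [lia|]. assert (q := Rmax_r 0 T). lra. }
  assert (Hxc : forall k t, continuous (x k) t).
  { intros k. apply (continuous_uniform_limit (fun i => X i k) (Lx k)).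
    - intros m. apply (approx_cont _ _ _ _ _ _ _ _ (HX m m (le_n m))).
    - intros T eps He. destruct (Hunif (Rmax 0 T) eps (Rmax_l 0 T) He) as [N HN].
      exists (Nat.max N k). intros t Ht. assert (q := Rmax_r 0 T). apply HN; [lia|lra|lia]. }
  assert (Hx01 : forall i k t, 0 <= t -> 0 <= X i k t <= 1).
  { intros i k t Ht. assert (a := HX i i (le_n i)).
    assert (p := approx_ge0 _ _ _ _ _ _ _ _ a k t Ht).
    assert (q := approx_term_le gamma _ k _ _ t a Ht). assert (j := pos_INR k).
    split; [exact p|nra]. }
  assert (Hx01' : forall k t, 0 <= t -> 0 <= x k t <= 1).
  { intros k t Ht. rewrite Hx_eq by exact Ht.
    apply (is_lim_seq_bounds (fun i => X i k t)); auto. }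
  assert (Hode : forall k t, 0 < t -> is_derive (x k) t (drift A B (th t) (fun j => x j t) k)).
  { intros k t Ht. apply (is_derive_Rmax0 (Lx k) t _ Ht).
    apply (is_derive_limit (fun i => X i k) (fun i t => drift A B (TH i t) (fun j => X i j t) k)
      (Lx k) (fun t => drift A B (th t) (fun j => x j t) k)); auto.
    - intros m. apply (approx_cont _ _ _ _ _ _ _ _ (HX m m (le_n m))).
    - intros s. apply continuous_drift; auto.
    - intros T eps He.
      set (c := (6 * beta + 2) * A (S k)).
      assert (Hc : 0 < c) by (unfold c; specialize (Ap (S k)); nra).
      destruct (Hunif (Rmax 0 T) (eps / c) (Rmax_l 0 T)) as [N HN].
      { apply Rdiv_lt_0_compat; lra. }
      (* Equation [k] involves [x (S k)], and the component [j] is close to its limit only from the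
         [j]-th solution on. *)
      exists (Nat.max N (S k)). intros m Hmm s Hs.
      assert (q := Rmax_r 0 T). assert (a := HX m m (le_n m)).
      split.
      + apply (approx_ode _ _ _ _ _ _ _ _ a); [lia|lra].
      + destruct (HN m s ltac:(lia) ltac:(lra)) as [N1 N2].
        replace eps with (c * (eps / c)) by (field; lra).
        apply drift_sub_le.
        * apply (approx_th_bound _ _ _ _ _ _ _ _ a). lra.
        * intros j. apply Hx01'. lra.
        * rewrite Hth_eq by lra. exact N1.
        * intros j Hj. rewrite Hx_eq by lra. apply N2. lia. }
  assert (Hup : forall m t, 0 <= t -> is_lim_seq (fun i => uptake A (fun k => X i k t) m)
                 (uptake A (fun k => x k t) m)).
  { intros m t Ht. apply (is_lim_seq_sum_f_R0 (fun i k => A k * X i k t)).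
    intros k _. rewrite Hx_eq by exact Ht.
    apply (is_lim_seq_scal_l (fun i => X i k t) (A k) (Lx k t)). auto. }
  assert (Hrel : forall m t, 0 <= t -> is_lim_seq (fun i => release B (fun k => X i k t) m)
                 (release B (fun k => x k t) m)).
  { intros m t Ht.
    assert (Hk : forall k, is_lim_seq (fun i => B k * X i k t) (B k * x k t)).
    { intros k. rewrite Hx_eq by exact Ht.
      apply (is_lim_seq_scal_l (fun i => X i k t) (B k) (Lx k t)). auto. }
    apply (is_lim_seq_plus' (fun i => sum_f_R0 (fun k => B k * X i k t) m)
      (fun i => B 0%nat * X i 0%nat t)); auto.
    apply (is_lim_seq_sum_f_R0 (fun i k => B k * X i k t)). auto. }
  exists th, x. intros n. split; auto.
  - intros t Ht. rewrite Hth_eq by exact Ht.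
    apply (is_lim_seq_bounds (fun i => TH i t)); auto. intros i.
    apply (approx_th_bound _ _ _ _ _ _ _ _ (HX i i (le_n i))), Ht.
  - intros k t Ht. apply Hx01', Ht.
  - intros m t Ht.
    apply (is_lim_seq_bounds (fun i => mass (fun k => X i k t) m) _ 0 1).
    + apply (is_lim_seq_sum_f_R0 (fun i k => (INR k + 2) * X i k t)). intros k _.
      rewrite Hx_eq by exact Ht.
      apply (is_lim_seq_scal_l (fun i => X i k t) (INR k + 2) (Lx k t)). auto.
    + intros i. split; [|apply (approx_mass _ _ _ _ _ _ _ _ (HX i i (le_n i))), Ht].
      apply sum_f_R0_nonneg. intros k _. assert (j := pos_INR k).
      apply Rmult_le_pos; [lra|apply Hx01, Ht].
  - intros m t Ht.
    rewrite <- (Rminus_0_r (th t * _ - _)).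
    apply is_lim_seq_abs_le with
      (fun i => TH i t * uptake A (fun k => X i k t) m - release B (fun k => X i k t) m) 0%nat.
    + apply is_lim_seq_minus'; [|auto]. apply is_lim_seq_mult'; [|auto].
      rewrite Hth_eq by exact Ht. auto.
    + intros i _. rewrite Rminus_0_r.
      apply (approx_defect _ _ _ _ _ _ _ _ (HX i i (le_n i))), Ht.
  - intros k _.
    assert (L1 := Hlim_x k 0 (Rle_refl 0)). rewrite <- Hx_eq in L1 by lra.
    assert (L2 : is_lim_seq (fun i => X i k 0) (gamma k)).
    { apply is_lim_seq_ext_loc with (fun _ => gamma k); [|apply is_lim_seq_const].
      exists k. intros i Hi. symmetry.
      apply (approx_initial _ _ _ _ _ _ _ _ (HX i i (le_n i))). lia. }
    assert (E : Finite (x k 0) = Finite (gamma k)).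
    { rewrite <- (is_lim_seq_unique _ _ L1). apply is_lim_seq_unique, L2. }
    injection E. auto.
Qed.

End Limit.

(** * Conservation law *)

(** The weight [k + 2] up to [M], then a descent of slope -1 that reaches 0 at [2 * M + 2]. Compact
    support removes the boundary terms of the summation by parts, and increments bounded by 1 keep
    the error within reach of [defect_approx]. *)
Definition tent (M k : nat) : R := Rmin (INR k + 2) (Rmax 0 (2 * INR M + 2 - INR k)).

Lemma tent_low (M k : nat) : (k <= M)%nat -> tent M k = INR k + 2.
Proof.
  intros H. apply le_INR in H. unfold tent. apply Rmin_left.
  apply Rle_trans with (2 := Rmax_r _ _). lra.
Qed.

Lemma tent_high (M k : nat) : (2 * M + 2 <= k)%nat -> tent M k = 0.
Proof.
  intros H. apply le_INR in H. rewrite plus_INR, mult_INR in H. simpl in H.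
  unfold tent. rewrite Rmax_left by lra. apply Rmin_right. assert (i := pos_INR k). lra.
Qed.

Lemma tent_bounds (M k : nat) : 0 <= tent M k <= INR k + 2.
Proof.
  unfold tent. assert (i := pos_INR k). split; [|apply Rmin_l].
  apply Rmin_glb; [lra|apply Rmax_l].
Qed.

Lemma tent_step (M k : nat) : Rabs (tent M (S k) - tent M k) <= 1.
Proof.
  unfold tent. rewrite S_INR. unfold Rmin, Rmax. apply Rabs_le.
  repeat destruct Rle_dec; lra.
Qed.

Definition tent_mass (x : nat -> R) (M : nat) : R :=
  sum_f_R0 (fun k => tent M k * x k) (2 * M + 2).

Lemma tent_mass_bounds (x : nat -> R) (M : nat) :
  (forall k, 0 <= x k) -> mass x M <= tent_mass x M <= mass x (2 * M + 2).
Proof.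
  intros Hx. split.
  - apply Rle_trans with (sum_f_R0 (fun k => tent M k * x k) M).
    + apply sum_Rle. intros k Hk. rewrite tent_low by exact Hk. lra.
    + apply sum_f_R0_le_wider; [|lia]. intros k. apply Rmult_le_pos; [apply tent_bounds|auto].
  - apply sum_Rle. intros k Hk. apply Rmult_le_compat_r; [auto|apply tent_bounds].
Qed.

Lemma mass_le_wider (x : nat -> R) (m n : nat) :
  (forall k, 0 <= x k) -> (m <= n)%nat -> mass x m <= mass x n.
Proof.
  intros Hx. apply sum_f_R0_le_wider. intros k. assert (i := pos_INR k).
  apply Rmult_le_pos; [lra|auto].
Qed.

Lemma exists_pos_of_mass_lim (x : nat -> R) :
  is_lim_seq (mass x) 1 -> exists k, 0 < x k.
Proof.
  intros L. apply is_lim_seq_spec in L.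
  destruct (L (mkposreal 1 Rlt_0_1)) as [m Hm]. specialize (Hm m (le_n m)). simpl in Hm.
  apply Rabs_lt_between in Hm. assert (P : 0 < mass x m) by lra. clear Hm.
  unfold mass in P. induction m as [|m IH]; [exists 0%nat; simpl in P; nra|].
  rewrite tech5 in P.
  destruct (Rlt_dec 0 (x (S m))) as [Q|Q]; [exists (S m); exact Q|].
  apply IH. assert (i := pos_INR (S m)).
  assert ((INR (S m) + 2) * x (S m) <= 0) by nra. lra.
Qed.

Section Conservation.

Context {A B r : nat -> R} {beta : R} (HAB : rates A B r beta).

(* Differentiating the full truncated mass would leave a boundary flux which is not
   small pointwise in time; the tent spreads it over [M, 2 M]. *)
Lemma tent_drift_le (th : R) (x : nat -> R) (m M : nat) :
  (m <= M)%nat -> 0 <= th -> (forall k, 0 <= x k) -> (forall n, mass x n <= 1) ->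
  Rabs (sum_f_R0 (fun k => tent M k * drift A B th x k) (2 * M + 2)
        - (th * uptake A x m - release B x m)) <= 2 * (th + beta) / A 0%nat * r m.
Proof.
  intros Hm Hth Hx Hmass. rewrite (sum_drift_by_parts A B th x (tent M)).
  rewrite (tent_high M (2 * M + 2)), (tent_high M (S (2 * M + 2))) by lia.
  rewrite !Rmult_0_l, Rminus_0_r, Rplus_0_r.
  apply (defect_approx HAB th x (fun k => tent M (S k) - tent M k)
    (fun k => tent M k - prev (tent M) k)); auto; [lia| | | |].
  - intros k Hk. rewrite !tent_low, S_INR by lia. ring.
  - intros k Hk. assert (s := tent_step M k). apply Rabs_le_between in s.
    destruct (le_dec k m); apply Rabs_le; lra.
  - intros k Hk. destruct k as [|k]; simpl prev.
    + rewrite tent_low by lia. simpl. ring.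
    + rewrite !tent_low, S_INR by lia. destruct (le_dec (S k) 0); [lia|ring].
  - intros k Hk. destruct k as [|k]; simpl prev.
    + rewrite tent_low by lia. destruct (le_dec 0 m); [|lia]. simpl.
      apply Rabs_le. lra.
    + assert (s := tent_step M k). apply Rabs_le_between in s.
      destruct (le_dec (S k) m), (le_dec (S k) 0); try lia; apply Rabs_le; lra.
Qed.

Lemma continuous_tent_mass (x : nat -> R -> R) (M : nat) (t : R) :
  (forall k s, continuous (x k) s) -> continuous (fun s => tent_mass (fun k => x k s) M) t.
Proof.
  intros Hx. apply (continuous_sum_f_R0 (fun k s => tent M k * x k s)). intros k _.
  apply (continuous_mult (fun _ => tent M k) (x k)); auto. apply continuous_const.
Qed.

Lemma is_derive_tent_mass (th : R -> R) (x : nat -> R -> R) (M : nat) (t : R) :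
  (forall k, is_derive (x k) t (drift A B (th t) (fun j => x j t) k)) ->
  is_derive (fun s => tent_mass (fun k => x k s) M) t
    (sum_f_R0 (fun k => tent M k * drift A B (th t) (fun j => x j t) k) (2 * M + 2)).
Proof.
  intros Hx. apply (is_derive_sum_f_R0 (fun k s => tent M k * x k s)
    (fun k s => tent M k * drift A B (th s) (fun j => x j s) k)).
  intros k _. apply (is_derive_scal (x k)), Hx.
Qed.

Context (gamma : nat -> R).

(** The mass is at most 1 by [approx], so only a loss has to be excluded. The derivative of the tent
    mass is bounded by two errors of size [6 * beta / A 0 * r M], one from the tent and one from the
    defect, which is the constant [c]. The tent mass at time 0 dominates [mass gamma M], and at time
    [t] it is dominated by the mass up to [2 * M + 2]. *)
Lemma approx_conservation (th : R -> R) (x : nat -> R -> R) (t : R) :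
  (forall n, approx A B r beta gamma n th x) -> is_lim_seq (mass gamma) 1 -> 0 <= t ->
  is_lim_seq (mass (fun k => x k t)) 1.
Proof.
  intros H Hg Ht.
  assert (hb := rates_beta_ge0 HAB). assert (A0 := rates_A_pos _ _ _ _ HAB 0%nat).
  assert (hr := rates_r_pos HAB).
  assert (Hx : forall k s, 0 <= s -> 0 <= x k s) by apply (approx_ge0 _ _ _ _ _ _ _ _ (H 0%nat)).
  set (c := 12 * beta / A 0%nat).
  assert (Hc : 0 <= c) by (apply Rdiv_le_0_compat; lra).
  assert (Hlow : forall M, mass gamma M - c * r M * t <= mass (fun k => x k t) (2 * M + 2)).
  { intros M.
    set (f := fun s => tent_mass (fun k => x k s) M).
    assert (E : Rabs ((fun s => f s - f 0) t) <= (fun s => c * r M * s) t).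
    { apply (abs_le_of_derive_le (fun s => f s - f 0)
        (fun s => sum_f_R0 (fun k => tent M k * drift A B (th s) (fun j => x j s) k) (2 * M + 2))
        (fun s => c * r M * s) (fun _ => c * r M) (t + 1)); [| | | | | |lra].
      - intros s. apply (continuous_minus f (fun _ => f 0)); [|apply continuous_const].
        apply continuous_tent_mass. apply (approx_cont _ _ _ _ _ _ _ _ (H 0%nat)).
      - intros s. apply (continuous_mult (fun _ => c * r M) (fun s => s)).
        apply continuous_const. apply continuous_id.
      - intros s Hs. rewrite <- (Rminus_0_r (sum_f_R0 _ _)).
        apply (is_derive_minus f (fun _ => f 0)); [|apply @is_derive_const].
        apply is_derive_tent_mass. intros k.
        apply (approx_ode _ _ _ _ _ _ _ _ (H k)); [lia|lra].
      - intros s Hs. auto_derive; [trivial|ring].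
      - intros s Hs.
        assert (b := approx_th_bound _ _ _ _ _ _ _ _ (H 0%nat) s ltac:(lra)).
        assert (D1 := tent_drift_le (th s) (fun k => x k s) M M (le_n M) (proj1 b)
          (fun k => Hx k s ltac:(lra))
          (fun n => approx_mass _ _ _ _ _ _ _ _ (H 0%nat) n s ltac:(lra))).
        assert (D2 := approx_defect _ _ _ _ _ _ _ _ (H 0%nat) M s ltac:(lra)).
        assert (D3 : 2 * (th s + beta) / A 0%nat * r M <= 6 * beta / A 0%nat * r M).
        { apply Rmult_le_compat_r; [left; apply hr|].
          apply Rmult_le_compat_r; [left; apply Rinv_0_lt_compat, A0|lra]. }
        replace (c * r M) with (6 * beta / A 0%nat * r M + 6 * beta / A 0%nat * r M)
          by (unfold c; field; lra).
        apply Rabs_le_between in D1. apply Rabs_le_between in D2. apply Rabs_le. lra.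
      - rewrite Rminus_diag, Rabs_R0. lra. }
    simpl in E. apply Rabs_le_between in E.
    assert (U := proj2 (tent_mass_bounds (fun k => x k t) M (fun k => Hx k t Ht))).
    assert (V := proj1 (tent_mass_bounds (fun k => x k 0) M (fun k => Hx k 0 (Rle_refl 0)))).
    assert (W : mass (fun k => x k 0) M = mass gamma M).
    { apply sum_eq. intros k Hk. f_equal. apply (approx_initial _ _ _ _ _ _ _ _ (H k)). lia. }
    unfold f in E. lra. }
  assert (Hsmall : is_lim_seq (fun M => mass gamma M - c * r M * t) 1).
  { replace 1 with (1 - c * t * 0) by ring.
    apply is_lim_seq_minus'; [exact Hg|].
    apply is_lim_seq_ext with (fun M => c * t * r M); [intros; ring|].
    apply (is_lim_seq_scal_l r (c * t) 0), (rates_r_lim _ _ _ _ HAB). }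
  apply is_lim_seq_spec. intros eps. apply is_lim_seq_spec in Hsmall.
  destruct (Hsmall eps) as [M HM]. exists (2 * M + 2)%nat. intros m Hm.
  specialize (HM M (le_n M)). specialize (Hlow M). apply Rabs_lt_between in HM.
  assert (U := approx_mass _ _ _ _ _ _ _ _ (H 0%nat) m t Ht).
  assert (V := mass_le_wider (fun k => x k t) _ _ (fun k => Hx k t Ht) Hm).
  assert (e := cond_pos eps). apply Rabs_lt_between. lra.
Qed.

Lemma is_lim_seq_tent_mass (x : nat -> R) :
  (forall k, 0 <= x k) -> is_lim_seq (mass x) 1 -> is_lim_seq (tent_mass x) 1.
Proof.
  intros Hx H. apply is_lim_seq_le_le with (mass x) (fun M => mass x (2 * M + 2)).
  - intros M. apply tent_mass_bounds, Hx.
  - exact H.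
  - apply (is_lim_seq_subseq (mass x) 1 (fun M => (2 * M + 2)%nat)); [|exact H].
    apply eventually_subseq. intros; lia.
Qed.

(* The tent mass converges to the constant [1], so its derivative, which is uniformly
   close to the defect, cannot keep a sign on an interval. *)
Lemma defect_le_of_conservation (th : R -> R) (x : nat -> R -> R) (m : nat) (t : R) :
  (forall t, continuous th t) -> (forall t, 0 <= t -> 0 <= th t) ->
  (forall k t, continuous (x k) t) -> (forall k t, 0 <= t -> 0 <= x k t) ->
  (forall k t, 0 < t -> is_derive (x k) t (drift A B (th t) (fun j => x j t) k)) ->
  (forall n t, 0 <= t -> mass (fun k => x k t) n <= 1) ->
  (forall t, 0 <= t -> is_lim_seq (mass (fun k => x k t)) 1) ->
  0 <= t ->
  Rabs (th t * uptake A (fun k => x k t) m - release B (fun k => x k t) m)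
  <= 2 * (th t + beta) / A 0%nat * r m.
Proof.
  intros Hthc Hth Hxc Hx Hode Hmass Hcons Ht.
  set (rho := fun t => th t * uptake A (fun k => x k t) m - release B (fun k => x k t) m).
  set (w := fun t => 2 * (th t + beta) / A 0%nat * r m).
  change (Rabs (rho t) <= w t).
  assert (Hlin : forall (p : nat -> R) s, continuous (fun s => sum_f_R0 (fun k => p k * x k s) m) s).
  { intros p s. apply (continuous_sum_f_R0 (fun k s => p k * x k s)). intros k _.
    apply (continuous_mult (fun _ => p k) (x k)); auto. apply continuous_const. }
  assert (Hrhoc : forall s, continuous rho s).
  { intros s. apply (continuous_minus (fun t => th t * uptake A (fun k => x k t) m)
      (fun t => release B (fun k => x k t) m)).
    - apply (continuous_mult th (fun t => uptake A (fun k => x k t) m)); [auto|apply Hlin].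
    - apply (continuous_plus (fun s => sum_f_R0 (fun k => B k * x k s) m)
        (fun s => B 0%nat * x 0%nat s)); [apply Hlin|].
      apply (continuous_mult (fun _ => B 0%nat) (x 0%nat)); auto. apply continuous_const. }
  assert (Hwc : forall s, continuous w s).
  { intros s. apply (continuous_mult (fun t => 2 * (th t + beta) / A 0%nat) (fun _ => r m));
      [|apply continuous_const].
    apply (continuous_mult (fun t => 2 * (th t + beta)) (fun _ => / A 0%nat));
      [|apply continuous_const].
    apply (continuous_mult (fun _ => 2) (fun t => th t + beta)); [apply continuous_const|].
    apply (continuous_plus th (fun _ => beta)); [auto|apply continuous_const]. }
  assert (Hsign : forall sg, sg = 1 \/ sg = -1 -> sg * rho t <= w t).
  { intros sg Hsg. apply Rnot_lt_le. intros Hlt.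
    (* By continuity the excess of [sg * rho] over [w] stays above [eta], half its value at [t], on
       [[t, t + d / 2]]. There [sg] times the tent mass gains at least [eta * (d / 2)], uniformly in
       [M], although its limits at the two ends coincide. Moving to the right of [t] includes the
       case [t = 0]. *)
    set (eta := (sg * rho t - w t) / 2).
    assert (Heta : 0 < eta) by (unfold eta; lra).
    assert (Hdc : continuous (fun s => sg * rho s - w s) t).
    { apply (continuous_minus (fun s => sg * rho s) w); [|apply Hwc].
      apply (continuous_mult (fun _ => sg) rho); [apply continuous_const|apply Hrhoc]. }
    rewrite continuous_eps in Hdc. destruct (Hdc eta Heta) as [d [Hd Hnear]].
    set (t1 := t + d / 2).
    assert (Hinc : forall M, (m <= M)%nat -> eta * (d / 2) <=
       sg * tent_mass (fun k => x k t1) M - sg * tent_mass (fun k => x k t) M).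
    { intros M HM.
      set (f := fun s => eta * s - sg * tent_mass (fun k => x k s) M).
      assert (E : f t1 <= f t).
      { apply (le_of_derive_nonpos f (fun s => eta - sg *
          sum_f_R0 (fun k => tent M k * drift A B (th s) (fun j => x j s) k) (2 * M + 2)) t t1).
        - intros s. apply (continuous_minus (fun s => eta * s)
            (fun s => sg * tent_mass (fun k => x k s) M)).
          + apply (continuous_mult (fun _ => eta) (fun s => s)).
            apply continuous_const. apply continuous_id.
          + apply (continuous_mult (fun _ => sg) (fun s => tent_mass (fun k => x k s) M)).
            apply continuous_const. apply continuous_tent_mass, Hxc.
        - intros s Hs. apply (is_derive_minus (fun s => eta * s)
            (fun s => sg * tent_mass (fun k => x k s) M)).
          + auto_derive; [trivial|ring].
          + apply (is_derive_scal (fun s => tent_mass (fun k => x k s) M)).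
            apply is_derive_tent_mass. intros k. apply Hode. lra.
        - intros s Hs. unfold t1 in Hs.
          assert (N := Hnear s ltac:(apply Rabs_lt_between; lra)).
          apply Rabs_lt_between in N.
          assert (D := tent_drift_le (th s) (fun k => x k s) m M HM (Hth s ltac:(lra))
            (fun k => Hx k s ltac:(lra)) (fun n => Hmass n s ltac:(lra))).
          fold (rho s) in D. fold (w s) in D. apply Rabs_le_between in D.
          assert (Hw : 2 * eta = sg * rho t - w t) by (unfold eta; field).
          destruct Hsg as [-> | ->]; lra.
        - unfold t1. lra. }
      unfold f, t1 in *. lra. }
    assert (L1 : is_lim_seq (fun M => sg * tent_mass (fun k => x k t1) M
        - sg * tent_mass (fun k => x k t) M) (sg * 1 - sg * 1)).
    { assert (Ht1 : 0 <= t1) by (unfold t1; lra).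
      apply is_lim_seq_minus'.
      - apply (is_lim_seq_scal_l _ sg 1), is_lim_seq_tent_mass; auto.
      - apply (is_lim_seq_scal_l _ sg 1), is_lim_seq_tent_mass; auto. }
    assert (L2 : Rbar_le (eta * (d / 2)) (sg * 1 - sg * 1)).
    { apply is_lim_seq_le_loc with (2 := is_lim_seq_const _) (3 := L1). exists m. exact Hinc. }
    simpl in L2. nra. }
  assert (S1 := Hsign 1 (or_introl eq_refl)). assert (S2 := Hsign (-1) (or_intror eq_refl)).
  apply Rabs_le. lra.
Qed.

Lemma approx_of_conservation (th : R -> R) (x : nat -> R -> R) :
  (forall t, continuous th t) -> (forall t, 0 <= t -> 0 <= th t) ->
  (forall k t, continuous (x k) t) -> (forall k t, 0 <= t -> 0 <= x k t) ->
  (forall k t, 0 < t -> is_derive (x k) t (drift A B (th t) (fun j => x j t) k)) ->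
  (forall t, 0 <= t -> is_lim_seq (mass (fun k => x k t)) 1) ->
  (forall k, x k 0 = gamma k) ->
  forall n, approx A B r beta gamma n th x.
Proof.
  intros Hthc Hth Hxc Hx Hode Hcons Hinit n.
  assert (hb := rates_beta_ge0 HAB). assert (Ap := rates_A_pos _ _ _ _ HAB).
  assert (A0 := Ap 0%nat).
  assert (Hmass : forall n t, 0 <= t -> mass (fun k => x k t) n <= 1).
  { intros m t Ht. apply (is_lim_seq_incr_compare (mass (fun k => x k t))); auto.
    intros i. apply mass_le_wider; auto. }
  assert (Hdef := fun m t => defect_le_of_conservation th x m t Hthc Hth Hxc Hx Hode Hmass Hcons).
  (* The bound on [th] is a consequence of the vanishing defect: as [release] is at most [2 * beta]
     times the uptake, an excess of [th] over [2 * beta] would leave a defect bounded below by a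
     fixed multiple of one positive term. *)
  assert (Hth2 : forall t, 0 <= t -> th t <= 2 * beta).
  { intros t Ht. apply Rnot_lt_le. intros Hlt.
    destruct (exists_pos_of_mass_lim (fun k => x k t) (Hcons t Ht)) as [k Hk].
    set (d := (th t - 2 * beta) * (A k * x k t)).
    assert (Hd : 0 < d).
    { unfold d. apply Rmult_lt_0_compat; [lra|]. apply Rmult_lt_0_compat; auto. }
    assert (Hle : Rbar_le d (2 * (th t + beta) / A 0%nat * 0)).
    { apply is_lim_seq_le_loc with (fun _ => d) (fun m => 2 * (th t + beta) / A 0%nat * r m).
      - exists k. intros m Hm. specialize (Hdef m t Ht).
        assert (b := proj2 (release_bounds HAB (fun k => x k t) m (fun k => Hx k t Ht))).
        assert (u : A k * x k t <= uptake A (fun k => x k t) m).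
        { apply (term_le_sum_f_R0 (fun k => A k * x k t)); [|exact Hm].
          intros j _. apply Rmult_le_pos; [left; apply Ap|auto]. }
        apply Rabs_le_between in Hdef. unfold d.
        apply Rle_trans with ((th t - 2 * beta) * uptake A (fun k => x k t) m); [|lra].
        apply Rmult_le_compat_l; lra.
      - apply is_lim_seq_const.
      - apply (is_lim_seq_scal_l r (2 * (th t + beta) / A 0%nat) 0), (rates_r_lim _ _ _ _ HAB). }
    simpl in Hle. lra. }
  split; auto.
  intros m t Ht. apply Rle_trans with (1 := Hdef m t Ht).
  specialize (Hth2 t Ht).
  apply Rmult_le_compat_r; [left; apply (rates_r_pos HAB)|].
  apply Rmult_le_compat_r; [left; apply Rinv_0_lt_compat, A0|lra].
Qed.

End Conservation.

(** * The coefficients of the paper *)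

Definition cbrt (k : nat) : R := Rpower (INR k + 2) (1 / 3).

Lemma cbrt_cube (k : nat) : cbrt k * cbrt k * cbrt k = INR k + 2.
Proof.
  assert (i := pos_INR k). unfold cbrt. rewrite <- !Rpower_plus.
  replace (1 / 3 + 1 / 3 + 1 / 3) with 1 by field. apply Rpower_1. lra.
Qed.

Lemma cbrt_mono (j k : nat) : (j <= k)%nat -> cbrt j <= cbrt k.
Proof.
  intros H. apply le_INR in H. assert (i := pos_INR j).
  unfold cbrt. apply Rle_Rpower_l; lra.
Qed.

Lemma cbrt_ge1 (k : nat) : 1 <= cbrt k.
Proof.
  assert (c := cbrt_cube k). assert (i := pos_INR k).
  assert (p : 0 < cbrt k) by apply exp_pos.
  apply Rnot_lt_le. intros H. assert (cbrt k * cbrt k < 1) by nra. nra.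
Qed.

(** Compare cubes: [(x + 1)^3 >= x^3 + 1] for [x >= 0]. *)
Lemma cbrt_succ_le (k : nat) : cbrt (S k) <= cbrt k + 1.
Proof.
  assert (c := cbrt_cube k). assert (c' := cbrt_cube (S k)). rewrite S_INR in c'.
  assert (p := cbrt_ge1 k). assert (p' := cbrt_ge1 (S k)).
  apply Rnot_lt_le. intros H.
  set (x := cbrt k) in *. set (y := cbrt (S k)) in *.
  assert (H1 : (x + 1) * (x + 1) < y * y) by nra.
  assert (H2 : (x + 1) * (x + 1) * (x + 1) < y * y * y) by nra.
  nra.
Qed.

Lemma is_lim_seq_inv_cbrt (c : R) : is_lim_seq (fun k => c / cbrt k) 0.
Proof.
  replace (Finite 0) with (Rbar_mult c (Rbar_inv p_infty)) by (simpl; f_equal; ring).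
  apply (is_lim_seq_scal_l (fun k => / cbrt k) c).
  apply is_lim_seq_inv; [|discriminate].
  apply is_lim_seq_spec. intros K.
  destruct (INR_unbounded (Rabs K * Rabs K * Rabs K)) as [N HN].
  exists N. intros k Hk. apply le_INR in Hk.
  assert (c1 := cbrt_cube k). assert (p := cbrt_ge1 k).
  apply Rle_lt_trans with (1 := Rle_abs K). assert (q := Rabs_pos K).
  apply Rnot_le_lt. intros H.
  assert (cbrt k * cbrt k <= Rabs K * Rabs K) by nra.
  assert (cbrt k * cbrt k * cbrt k <= Rabs K * Rabs K * Rabs K) by nra. lra.
Qed.

Lemma a_coef_cbrt (a1 : R) (k : nat) : a_coef a1 (k + 2) = a1 * cbrt k.
Proof. unfold a_coef, cbrt. rewrite plus_INR. reflexivity. Qed.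

Lemma b_coef_cbrt (a1 zs q : R) (k : nat) :
  b_coef a1 zs q (k + 2) = a1 * cbrt k * (zs + q / cbrt k).
Proof. unfold b_coef. rewrite a_coef_cbrt. unfold cbrt. rewrite plus_INR. reflexivity. Qed.

(** The rate is explicit: [A k ^ 2 / (k + 2) = a1 ^ 2 / cbrt k], which decreases in [k]. The
    constant [zs + q] bounds [B k / A k = zs + q / cbrt k] because cube roots of sizes are at least
    1, and the same fact bounds the increment [a1] of [A] by [A 0]. *)
Lemma rates_coef (a1 zs q : R) : 0 < a1 -> 0 < zs -> 0 < q ->
  rates (fun k => a_coef a1 (k + 2)) (fun k => b_coef a1 zs q (k + 2))
    (fun n => a1 * a1 / cbrt n) (zs + q).
Proof.
  intros Ha Hz Hq. assert (g := cbrt_ge1).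
  split; intros; cbv beta; rewrite ?a_coef_cbrt, ?b_coef_cbrt.
  - specialize (g k). nra.
  - apply Rmult_le_compat_l; [lra|]. apply cbrt_mono. lia.
  - assert (m := cbrt_succ_le k). specialize (g 0%nat).
    apply Rle_trans with (a1 * (cbrt k + cbrt 0)); [|right; ring].
    apply Rmult_le_compat_l; lra.
  - specialize (g k).
    assert (0 < q / cbrt k) by (apply Rdiv_lt_0_compat; lra).
    apply Rmult_le_pos; nra.
  - specialize (g k). assert (q / cbrt k <= q).
    { apply Rmult_le_reg_r with (cbrt k); [lra|].
      replace (q / cbrt k * cbrt k) with q by (field; lra). nra. }
    rewrite (Rmult_comm (zs + q)). apply Rmult_le_compat_l; nra.
  - assert (m := cbrt_mono n k H). assert (c := cbrt_cube k).
    assert (gn := g n). specialize (g k).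
    apply Rmult_le_reg_r with (cbrt n); [lra|].
    replace (a1 * a1 / cbrt n * (INR k + 2) * cbrt n) with (a1 * a1 * (INR k + 2)) by (field; lra).
    rewrite <- c.
    replace (a1 * cbrt k * (a1 * cbrt k) * cbrt n)
      with (a1 * a1 * (cbrt k * cbrt k * cbrt n)) by ring.
    apply Rmult_le_compat_l; [nra|]. apply Rmult_le_compat_l; nra.
  - apply is_lim_seq_inv_cbrt.
Qed.

Lemma is_series_mass (x : nat -> R) (l : R) :
  is_series (fun k => INR (k + 2) * x k) l <-> is_lim_seq (mass x) l.
Proof.
  assert (E : forall m, sum_n (fun k => INR (k + 2) * x k) m = mass x m).
  { intros m. rewrite sum_n_Reals. apply sum_eq. intros k _.
    rewrite plus_INR. reflexivity. }
  split; intros H.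
  - apply is_lim_seq_ext with (1 := E). exact H.
  - apply (is_lim_seq_ext _ _ _ (fun m => eq_sym (E m)) H).
Qed.

Lemma J_drift (a1 zs q : R) (c1 : R -> R) (c : nat -> R -> R) (k : nat) (t : R) :
  c 1%nat t = 0 ->
  J a1 zs q c1 c (k + 2 - 1) t - J a1 zs q c1 c (k + 2) t =
  drift (fun k => a_coef a1 (k + 2)) (fun k => b_coef a1 zs q (k + 2)) (c1 t)
    (fun j => c (j + 2)%nat t) k.
Proof.
  intros H. unfold J, drift.
  replace (k + 2 - 1 + 1)%nat with (k + 2)%nat by lia.
  replace (k + 2 + 1)%nat with (S k + 2)%nat by lia.
  replace (k + 2 - 1)%nat with (k + 1)%nat by lia.
  destruct k as [|k]; simpl prev.
  - simpl (0 + 1)%nat. rewrite H. ring.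
  - replace (S k + 1)%nat with (k + 2)%nat by lia. ring.
Qed.

(** * Passage between the original system and [approx], and uniqueness *)

Lemma global_solution_approx (a1 zs q : R) (gamma : nat -> R)
    (c1 : R -> R) (c : nat -> R -> R) : 0 < a1 -> 0 < zs -> 0 < q ->
  is_global_solution a1 zs q gamma c1 c ->
  forall n, approx (fun k => a_coef a1 (k + 2)) (fun k => b_coef a1 zs q (k + 2))
    (fun n => a1 * a1 / cbrt n) (zs + q) (fun k => gamma (k + 2)%nat) n
    (fun t => c1 (Rmax 0 t)) (fun k t => c (k + 2)%nat (Rmax 0 t)).
Proof.
  intros Ha Hz Hq [H1 H2 H3 H4 H5 H6 H7 H8].
  assert (R0 : forall t, 0 <= Rmax 0 t) by (intros; apply Rmax_l).
  apply (approx_of_conservation (rates_coef a1 zs q Ha Hz Hq)).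
  - apply continuous_Rmax0, H1.
  - intros t _. apply H2, R0.
  - intros k. apply continuous_Rmax0, H3. lia.
  - intros k t _. apply H4; [lia|apply R0].
  - intros k t Ht. apply (is_derive_Rmax0 (c (k + 2)%nat) t _ Ht).
    rewrite Rmax_right by lra.
    rewrite <- (J_drift a1 zs q c1 c k t) by (apply H6; lra).
    apply H5; [lia|exact Ht].
  - intros t _. apply is_series_mass. apply (H8 (Rmax 0 t) (R0 t)).
  - intros k. rewrite Rmax_left by lra. apply H7. lia.
Qed.

Lemma approx_global_solution (a1 zs q : R) (gamma : nat -> R)
    (th : R -> R) (x : nat -> R -> R) : 0 < a1 -> 0 < zs -> 0 < q ->
  is_lim_seq (mass (fun k => gamma (k + 2)%nat)) 1 ->
  (forall n, approx (fun k => a_coef a1 (k + 2)) (fun k => b_coef a1 zs q (k + 2))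
    (fun n => a1 * a1 / cbrt n) (zs + q) (fun k => gamma (k + 2)%nat) n th x) ->
  is_global_solution a1 zs q gamma th
    (fun l t => match l with S (S k) => x k t | _ => 0 end).
Proof.
  intros Ha Hz Hq Hg H.
  set (c := fun l t => match l with S (S k) => x k t | _ => 0 end).
  assert (Hc : forall k t, c (k + 2)%nat t = x k t)
    by (intros; replace (k + 2)%nat with (S (S k)) by lia; reflexivity).
  assert (Hl : forall l, (2 <= l)%nat -> exists k, l = (k + 2)%nat)
    by (intros l Hl; exists (l - 2)%nat; lia).
  split.
  - apply continuous_on_forall. intros t _.
    apply (approx_th_cont _ _ _ _ _ _ _ _ (H 0%nat)).
  - intros t Ht. apply (approx_th_bound _ _ _ _ _ _ _ _ (H 0%nat)), Ht.
  - intros [|[|k]] Hk; try lia.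
    apply continuous_on_forall. intros t _.
    apply (approx_cont _ _ _ _ _ _ _ _ (H 0%nat)).
  - intros [|[|k]] t Hk Ht; try lia. apply (approx_ge0 _ _ _ _ _ _ _ _ (H 0%nat)), Ht.
  - intros l t Hk Ht. destruct (Hl l Hk) as [k ->].
    rewrite J_drift by reflexivity.
    apply is_derive_ext with (x k); [intros; symmetry; apply Hc|].
    replace (drift _ _ (th t) _ k) with
      (drift (fun k => a_coef a1 (k + 2)) (fun k => b_coef a1 zs q (k + 2)) (th t)
        (fun j => x j t) k).
    + apply (approx_ode _ _ _ _ _ _ _ _ (H k)); [lia|exact Ht].
    + unfold drift. rewrite !Hc. destruct k as [|k]; simpl prev; rewrite ?Hc; reflexivity.
  - reflexivity.
  - intros l Hk. destruct (Hl l Hk) as [k ->]. rewrite Hc.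
    apply (approx_initial _ _ _ _ _ _ _ _ (H k)). lia.
  - intros t Ht.
    apply is_series_ext with (fun k => INR (k + 2) * x k t); [intros; rewrite Hc; reflexivity|].
    apply is_series_mass.
    apply (approx_conservation (rates_coef a1 zs q Ha Hz Hq) _ th x t H Hg Ht).
Qed.

(** Exact solutions satisfy [approx] for every [n], so the stability bound [C * r n] holds with
    arbitrarily large [n] and tends to 0. *)
Lemma approx_unique (A B r : nat -> R) (beta : R) (gamma : nat -> R) (k0 : nat)
    (th th' : R -> R) (x x' : nat -> R -> R) :
  rates A B r beta -> 0 < gamma k0 ->
  (forall n, approx A B r beta gamma n th x) ->
  (forall n, approx A B r beta gamma n th' x') ->
  forall t, 0 <= t -> th t = th' t /\ forall k, x k t = x' k t.
Proof.
  intros HAB Hk0 H H' t Ht.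
  destruct (approx_stable HAB gamma k0 t Hk0 Ht) as [C [HC Hst]].
  assert (Hz : forall y N, (forall n, (N <= n)%nat -> Rabs y <= C * r n) -> y = 0).
  { intros y N Hy.
    assert (L : Rbar_le (Rabs y) (C * 0)).
    { apply is_lim_seq_le_loc with (fun _ => Rabs y) (fun n => C * r n).
      - exists N. exact Hy.
      - apply is_lim_seq_const.
      - apply (is_lim_seq_scal_l r C 0), (rates_r_lim _ _ _ _ HAB). }
    simpl in L. apply Rabs_eq_0. assert (p := Rabs_pos y). lra. }
  assert (Ap := rates_A_pos _ _ _ _ HAB).
  split.
  - apply Rminus_diag_uniq, (Hz _ k0). intros n Hn.
    apply (Hst n th x th' x' Hn (H n) (H' n) t ltac:(lra)).
  - intros k. assert (E : A k * (x k t - x' k t) = 0).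
    { apply (Hz _ (Nat.max k k0)). intros n Hn.
      apply Rle_trans with (2 := proj1 (Hst n th x th' x' ltac:(lia) (H n) (H' n) t ltac:(lra))).
      rewrite Rabs_mult, (Rabs_right (A k)) by (left; apply Ap).
      apply (term_le_sum_f_R0 (fun k => A k * Rabs (x k t - x' k t))); [|lia].
      intros j _. apply Rmult_le_pos; [left; apply Ap|apply Rabs_pos]. }
    apply Rmult_integral in E. specialize (Ap k). destruct E; lra.
Qed.

Theorem theorem2p2 (a1 zs q : R) (ha1 : 0 < a1) (hzs : 0 < zs) (hq : 0 < q)
    (gamma : nat -> R)
    (hgamma_ge0 : forall l : nat, (1 <= l)%nat -> 0 <= gamma l)
    (hgamma1 : gamma 1%nat = 0)
    (hgamma_mass : is_series (fun k : nat => INR (k + 2) * gamma (k + 2)%nat) 1) :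
  exists (c1 : R -> R) (c : nat -> R -> R),
    is_global_solution a1 zs q gamma c1 c /\
    forall (c1' : R -> R) (c' : nat -> R -> R),
      is_global_solution a1 zs q gamma c1' c' ->
      (forall t : R, 0 <= t -> c1' t = c1 t) /\
      (forall (l : nat) (t : R), (2 <= l)%nat -> 0 <= t -> c' l t = c l t).
Proof.
  set (g := fun k => gamma (k + 2)%nat).
  assert (Hg0 : forall k, 0 <= g k) by (intros; apply hgamma_ge0; lia).
  assert (Hmass : is_lim_seq (mass g) 1) by (apply is_series_mass, hgamma_mass).
  assert (Hle : forall m, mass g m <= 1).
  { intros m. apply (is_lim_seq_incr_compare (mass g)); [exact Hmass|].
    intros i. apply mass_le_wider; auto. }
  (* Unit mass provides the initially populated size on which the lower bound of the uptake
     rests. *)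
  destruct (exists_pos_of_mass_lim g Hmass) as [k0 Hk0].
  assert (HAB := rates_coef a1 zs q ha1 hzs hq).
  destruct (approx_limit HAB g k0 Hg0 Hk0 Hle) as [th [x Hx]].
  eexists; eexists. split.
  - apply (approx_global_solution a1 zs q gamma th x ha1 hzs hq Hmass Hx).
  - intros c1' c' H'.
    assert (Hx' := global_solution_approx a1 zs q gamma c1' c' ha1 hzs hq H').
    assert (U := approx_unique _ _ _ _ _ k0 _ _ _ _ HAB Hk0 Hx' Hx). cbv beta in U.
    split.
    + intros t Ht. destruct (U t Ht) as [U1 _]. rewrite Rmax_right in U1 by lra. exact U1.
    + intros [|[|k]] t Hl Ht; try lia. destruct (U t Ht) as [_ U2]. specialize (U2 k).
      rewrite Rmax_right in U2 by lra. replace (k + 2)%nat with (S (S k)) in U2 by lia.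
      exact U2.
Qed.
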